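(* Let $X$ be a complex Banach space, let $T$ be a bounded linear operator on $X$ with adjoint $T^*$, and let $\Omega$ be a connected component of $\rho_{pBF}(T)$. Then the following alternative holds: (1) either $T^*$ has the SVEP at every point of $\Omega$; in this case, $\sigma_{su}(T)$ has no limit points in $\Omega$, and every point of $\Omega$ is not a deficiency value of $T$, except for a subset of $\Omega$ which consists of at most countably many isolated points; (2) or $T^*$ has the SVEP at no point of $\Omega$; in this case, every point of $\Omega$ is a deficiency value of $T$.
   Context: A bounded operator $T$ on $X$ is Fredholm if its kernel is finite-dimensional and its range has finite codimension; it is quasi-nilpotent if $\sigma(T)\subseteq\{0\}$. $T$ is pseudo B-Fredholm if there are closed $T$-invariant subspaces $X_1,X_2$ with $X=X_1\oplus X_2$, $T|_{X_1}$ Fredholm and $T|_{X_2}$ quasi-nilpotent. $\rho_{pBF}(T)=\{\lambda\in\mathbb{C}: T-\lambda\text{ is pseudo B-Fredholm}\}$. A bounded operator $S$ on a complex Banach space $Y$ has the single valued extension property (SVEP) at $\lambda_0\in\mathbb{C}$ if for every open neighbourhood $U\subseteq\mathbb{C}$ of $\lambda_0$, the only analytic function $f:U\to Y$ satisfying $(S-zI)f(z)=0$ for all $z\in U$ is $f\equiv 0$. The adjoint $T^*$ is the Banach space adjoint acting on the dual of $X$. $\sigma_{su}(T)$ is the surjectivity spectrum, i.e. the set of $\lambda\in\mathbb{C}$ such that $T-\lambda$ is not surjective; a deficiency value of $T$ is a $\lambda\in\mathbb{C}$ such that $T-\lambda$ is not surjective.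
   Formalization: In the definition of the SVEP at a point, only connected open neighbourhoods U are tested; with arbitrary, possibly disconnected, open neighbourhoods the SVEP at one point would force it at all points, and the alternative fails, e.g. for the right shift on the exterior of the disc. *)

(* Defs.v *)
From HB Require Import structures.
From mathcomp Require Import all_boot all_order all_algebra.
From mathcomp Require Import all_classical all_reals all_analysis.
From mathcomp Require Import complex.

Set Implicit Arguments.
Unset Strict Implicit.
Unset Printing Implicit Defensive.

Import Order.TTheory GRing.Theory Num.Theory.
Import numFieldNormedType.Exports.

Local Open Scope classical_set_scope.
Local Open Scope ring_scope.
Local Open Scope complex_scope.

(* Scalars are [R[i]]; a subset of the complex plane has type [set R[i]^o],
   because the topology of [R[i]] is carried by its regular module [R[i]^o].
   A complex Banach space is a [completeNormedModType R[i]]; its norm takes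
   values in [R[i]], namely in the nonnegative reals. *)

Section Dual.
Context {R : realType}.
Variable X : normedModType R[i].

Definition dual_pred : {pred X -> R[i]^o} :=
  fun f => `[< linear f /\ continuous f >].

Lemma dual_pred_submod_closed : submod_closed dual_pred.
Proof.
split=> [|a f g].
- apply/asboolP; split; first by move=> a x y /=; rewrite scaler0 addr0.
  by move=> x; exact: cvg_cst.
- move=> /asboolP[lf cf] /asboolP[lg cg]; apply/asboolP; split.
    move=> b x y; rewrite /= !fctE lf lg !scalerDr !scalerA (mulrC a b).
    by rewrite addrACA.
  move=> x.
  have h : (a \*: f) \+ g @ x --> (a *: f x + g x : R[i]^o).
    by apply: cvgD; [apply: cvgZr; exact: cf | exact: cg].
  exact: h.
Qed.

HB.instance Definition _ := GRing.isSubmodClosed.Build R[i] (X -> R[i]^o)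
  dual_pred dual_pred_submod_closed.

Record dual := Dual { dual_fun :> X -> R[i]^o; _ : dual_fun \in dual_pred }.

HB.instance Definition _ := [isSub for dual_fun].
HB.instance Definition _ := gen_eqMixin dual.
HB.instance Definition _ := gen_choiceMixin dual.
HB.instance Definition _ := [SubChoice_isSubLmodule of dual by <:].

Lemma dual_linear (f : dual) : linear f.
Proof. by have /asboolP[] := valP f. Qed.

Lemma dual_continuous (f : dual) : continuous f.
Proof. by have /asboolP[] := valP f. Qed.

HB.instance Definition _ (f : dual) :=
  GRing.isLinear.Build R[i] X R[i]^o _ (dual_fun f) (dual_linear f).

Definition dual_norm (f : dual) : R[i] :=
  (sup [set complex.Re `|f x| | x in [set x : X | `|x| <= 1]])%:C.

Lemma Re_normK (V : normedModType R[i]) (v : V) :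
  (complex.Re `|v|)%:C = `|v| :> R[i].
Proof. by rewrite RRe_real// ger0_real. Qed.

Lemma dual_norm_has_sup (f : dual) :
  has_sup [set complex.Re `|f x| | x in [set x : X | `|x| <= 1]].
Proof.
split; first by exists (complex.Re `|f 0|), 0 => //=; rewrite normr0.
have /linear_boundedP/pinfty_ex_gt0[r r0 fr] :
    bounded_near (dual_fun f) (nbhs (0 : X)).
  by apply/linear_bounded_continuous; exact: dual_continuous.
exists (complex.Re r) => _ [x /= x1 <-].
have : `|f x| <= r by rewrite (le_trans (fr x))// ler_piMr// ltW.
by rewrite lecE => /andP[].
Qed.

Lemma ler_dual_norm1 (f : dual) (x : X) : `|x| <= 1 -> `|f x| <= dual_norm f.
Proof.
move=> x1; rewrite -Re_normK /dual_norm lecR.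
by apply: ub_le_sup; [case: (dual_norm_has_sup f) | exists x].
Qed.

Lemma dual_norm_ge0 (f : dual) : 0 <= dual_norm f.
Proof. by apply: le_trans (@ler_dual_norm1 f 0 _); rewrite ?normr0. Qed.

Lemma ler_dual_norm (f : dual) (x : X) : `|f x| <= dual_norm f * `|x|.
Proof.
have [->|x0] := eqVneq x 0; first by rewrite linear0 !normr0 mulr0.
have nx : 0 < `|x| by rewrite normr_gt0.
have := @ler_dual_norm1 f (`|x|^-1 *: x).
rewrite normrZ normfV normr_id mulVf ?gt_eqF// => /(_ (lexx _)).
by rewrite linearZ/= normrZ normfV normr_id mulrC ler_pdivrMr.
Qed.

Lemma dual_norm_le (f : dual) (M : R[i]) : 0 <= M ->
  (forall x, `|x| <= 1 -> `|f x| <= M) -> dual_norm f <= M.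
Proof.
move=> M0 fM; rewrite -[M]RRe_real ?ger0_real// /dual_norm lecR.
apply: sup_le_ub => [|_ [x /= x1 <-]]; first by case: (dual_norm_has_sup f).
by have := fM _ x1; rewrite lecE => /andP[].
Qed.

Lemma dual_normD (f g : dual) :
  dual_norm (f + g) <= dual_norm f + dual_norm g.
Proof.
apply: dual_norm_le => [|x x1]; first by rewrite addr_ge0 ?dual_norm_ge0.
by rewrite (le_trans (ler_normD (f x) (g x)))// lerD ?ler_dual_norm1.
Qed.

Lemma dual_normZ_le (a : R[i]) (f : dual) :
  dual_norm (a *: f) <= `|a| * dual_norm f.
Proof.
apply: dual_norm_le => [|x x1]; first by rewrite mulr_ge0 ?dual_norm_ge0.
by rewrite [leLHS](normrZ a (f x)) ler_wpM2l ?ler_dual_norm1.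
Qed.

Lemma dual_normZ (a : R[i]) (f : dual) :
  dual_norm (a *: f) = `|a| * dual_norm f.
Proof.
apply/eqP; rewrite eq_le dual_normZ_le/=.
have [->|a0] := eqVneq a 0; first by rewrite normr0 mul0r dual_norm_ge0.
rewrite -ler_pdivlMl ?normr_gt0// -normfV.
by rewrite -{1}[f](scalerK a0) dual_normZ_le.
Qed.

Lemma dual_norm0_eq0 (f : dual) : dual_norm f = 0 -> f = 0.
Proof.
move=> f0; apply: val_inj; apply/funext => x /=.
by apply/eqP; rewrite -normr_le0 (le_trans (ler_dual_norm f x))// f0 mul0r.
Qed.

HB.instance Definition _ := @Lmodule_isNormed.Build R[i] dual
  dual_norm dual_normD dual_normZ dual_norm0_eq0.

End Dual.

Section Adjoint.
Context {R : realType}.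
Variables (X : normedModType R[i]) (T : {linear X -> X}).
Hypothesis T_continuous : continuous T.

Lemma adjoint_subproof (f : dual X) :
  (fun x => f (T x)) \in @dual_pred R X.
Proof.
apply/asboolP; split=> [a x y|x]; first by rewrite !linearP.
by apply: continuous_comp; [exact: T_continuous | exact: dual_continuous].
Qed.

Definition adjoint (f : dual X) : dual X := Dual (adjoint_subproof f).

End Adjoint.

Section Subspace.
Context {R : realType}.
Variable X : normedModType R[i].

Record closed_subspace := ClosedSubspace {
  csub_set :> X -> Prop;
  csub0 : csub_set 0;
  csub_lin : forall (a : R[i]) x y,
    csub_set x -> csub_set y -> csub_set (a *: x + y);
  csub_closed : closed (csub_set : set X) }.

Section Sub.
Variable M : closed_subspace.

Definition csub_pred : {pred X} := fun x => `[< M x >].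

Lemma csub_pred_submod_closed : submod_closed csub_pred.
Proof.
split=> [|a x y]; first by apply/asboolP; exact: csub0.
by move=> /asboolP Mx /asboolP My; apply/asboolP; exact: csub_lin.
Qed.

HB.instance Definition _ := GRing.isSubmodClosed.Build R[i] X
  csub_pred csub_pred_submod_closed.

(* The subspace [M] as a space in its own right, with the norm of [X]. *)
Record csub := Csub { csub_val :> X; _ : csub_val \in csub_pred }.

HB.instance Definition _ := [isSub for csub_val].
HB.instance Definition _ := [Choice of csub by <:].
HB.instance Definition _ := [SubChoice_isSubLmodule of csub by <:].

Lemma csubP (x : csub) : M x.
Proof. by have /asboolP := valP x. Qed.

Definition csub_norm (x : csub) : R[i] := `|csub_val x|.

Lemma csub_normD (x y : csub) :
  csub_norm (x + y) <= csub_norm x + csub_norm y.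
Proof. exact: ler_normD. Qed.

Lemma csub_normZ (a : R[i]) (x : csub) :
  csub_norm (a *: x) = `|a| * csub_norm x.
Proof. exact: normrZ. Qed.

Lemma csub_norm0_eq0 (x : csub) : csub_norm x = 0 -> x = 0.
Proof. by move=> /normr0_eq0 x0; exact: val_inj. Qed.

HB.instance Definition _ := @Lmodule_isNormed.Build R[i] csub
  csub_norm csub_normD csub_normZ csub_norm0_eq0.

Section Restrict.
Variable T : X -> X.

Definition invariant_subspace := forall x, M x -> M (T x).

Hypothesis TM : invariant_subspace.

Lemma restrict_subproof (x : csub) : T x \in csub_pred.
Proof. by apply/asboolP; apply: TM; exact: csubP. Qed.

Definition restrict_op (x : csub) : csub := Csub (restrict_subproof x).

End Restrict.
End Sub.

Definition direct_sum (M N : closed_subspace) :=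
  csub_set M `&` csub_set N = [set 0] /\ [set u + v | u in csub_set M & v in csub_set N] = [set: X].

End Subspace.

Section Operators.
Context {R : realType}.

Section Span.
Variable V : lmodType R[i].

Definition lspan n (e : 'I_n -> V) : set V :=
  range (fun c : 'I_n -> R[i] => \sum_(i < n) c i *: e i).

Definition finite_dim (A : set V) := exists n (e : 'I_n -> V), A = lspan e.

(* [V / A] is spanned by finitely many classes. *)
Definition finite_codim (A : set V) := exists n (e : 'I_n -> V),
  [set a + v | a in A & v in lspan e] = [set: V].

Definition Fredholm (S : V -> V) :=
  finite_dim (S @^-1` [set 0]) /\ finite_codim (range S).

Definition shift_op (S : V -> V) (l : R[i]) : V -> V := fun x => S x - l *: x.

Definition deficiency_value (S : V -> V) (l : R[i]) :=
  ~ set_surj [set: V] [set: V] (shift_op S l).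

Definition surjectivity_spectrum (S : V -> V) : set R[i]^o :=
  [set l | ~ set_surj [set: V] [set: V] (shift_op S l)].

End Span.

Section Spectrum.
Variable Y : normedModType R[i].

Definition resolvent_set (S : Y -> Y) : set R[i]^o :=
  [set l | exists Q : {linear Y -> Y}, [/\ continuous Q,
     cancel (shift_op S l) Q & cancel Q (shift_op S l)]].

Definition spectrum (S : Y -> Y) : set R[i]^o := ~` resolvent_set S.

Definition quasi_nilpotent (S : Y -> Y) := spectrum S `<=` [set 0].

End Spectrum.

Section PseudoBFredholm.
Variable Y : normedModType R[i].

Definition pseudo_B_Fredholm (S : Y -> Y) :=
  exists (M N : closed_subspace Y)
         (SM : invariant_subspace M S) (SN : invariant_subspace N S),
    [/\ direct_sum M N,
        Fredholm (restrict_op SM) & quasi_nilpotent (restrict_op SN)].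

Definition rho_pBF (S : Y -> Y) : set R[i]^o :=
  [set l | pseudo_B_Fredholm (shift_op S l)].

(* Local representability by norm-convergent power series. *)
Definition analytic_on (U : set R[i]^o) (f : R[i]^o -> Y) :=
  forall z0, U z0 -> exists a : nat -> Y, \forall z \near z0,
    series (fun n => (z - z0 : R[i]) ^+ n *: a n) @ \oo --> f z.

(* Only connected neighbourhoods are tested (equivalently, open discs around
   [l0]): on a disconnected [U], a nonzero [f] supported away from the
   component of [l0] would make the property depend on all points of the plane
   and not on [l0] alone. *)
Definition SVEP (S : Y -> Y) (l0 : R[i]^o) :=
  forall U : set R[i]^o, open U -> connected U -> U l0 ->
  forall f : R[i]^o -> Y, analytic_on U f ->
    (forall z, U z -> shift_op S z (f z) = 0) ->
    forall z, U z -> f z = 0.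

End PseudoBFredholm.
End Operators.

(* Main.v *)
(** If [T - l] splits as a Fredholm operator on [M] plus a quasi-nilpotent one
    on [N], let [w] be the least codimension in [M] of the subspaces
    [(T - l) M + ker ((T - l)|M) ^ n], [n >= 0].

    If [w = 0], then every [y] is [(T - l) x + u + v] with [x] in [M], [u] in
    the kernel of a power of [T - l] and [v] in [N], with [x], [u], [v]
    controlled by [y] (open mapping theorem); since [u] and [v] lie in the range
    of [T - l - m] for every [m <> 0], successive approximation shows that
    [T - l - m] is surjective for all small [m <> 0].

    If [w > 0], a functional [g 0] vanishing on these subspaces and on [N] can
    be lifted step by step to [g (k + 1) \o (T - l) = g k], with geometric
    growth; the sum of the [m ^ k g k] is an analytic family of nonzero
    functionals, each vanishing on the range of [T - l - m], so that
    [T - l - m] is not surjective and [T^*] fails the SVEP at [l].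

    Both alternatives are open in [l] and they exclude each other, hence only
    one of them occurs on a component.  In the first case the identity theorem
    gives the SVEP, because [T^* - z] is injective wherever [T - z] is
    surjective. *)

Require Import Defs.
From HB Require Import structures.
From mathcomp Require Import all_boot all_order all_algebra.
From mathcomp Require Import all_classical all_reals all_analysis.
From mathcomp Require Import complex.
From mathcomp Require Import ring lra.

Set Implicit Arguments.
Unset Strict Implicit.
Unset Printing Implicit Defensive.

Import Order.TTheory GRing.Theory Num.Theory.
Import numFieldNormedType.Exports.

Local Open Scope classical_set_scope.
Local Open Scope ring_scope.
Local Open Scope complex_scope.

(** * Real-valued norms and completeness *)

Section RealNorm.
Context {R : realType}.
Implicit Type V : normedModType R[i].

(* Norms over [R[i]] take values in [R[i]]; estimates are easier in [R]. *)
Definition rnorm V (x : V) : R := complex.Re `|x|.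

Lemma rnormE V (x : V) : (rnorm x)%:C = `|x|.
Proof. exact: Re_normK. Qed.

Lemma rnorm_ge0 V (x : V) : 0 <= rnorm x.
Proof. by rewrite -lecR rnormE; exact: normr_ge0. Qed.

Lemma rnorm0 V : rnorm (0 : V) = 0.
Proof. by rewrite /rnorm normr0. Qed.

Lemma rnorm_eq0 V (x : V) : rnorm x = 0 -> x = 0.
Proof. by move=> x0; apply/normr0_eq0; rewrite -rnormE x0. Qed.

Lemma rnorm_gt0 V (x : V) : x != 0 -> 0 < rnorm x.
Proof.
rewrite lt_def rnorm_ge0 andbT; apply: contra_neq; exact: rnorm_eq0.
Qed.

Lemma rnormN V (x : V) : rnorm (- x) = rnorm x.
Proof. by rewrite /rnorm normrN. Qed.

Lemma rnormB V (x y : V) : rnorm (x - y) = rnorm (y - x).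
Proof. by rewrite /rnorm distrC. Qed.

Lemma rnormD V (x y : V) : rnorm (x + y) <= rnorm x + rnorm y.
Proof. by rewrite -lecR rmorphD/= !rnormE ler_normD. Qed.

Lemma rnorm_le_distD V (y x z : V) :
  rnorm (x - z) <= rnorm (x - y) + rnorm (y - z).
Proof. by rewrite -[x - z](subrKA y) rnormD. Qed.

Lemma rnormZ V (a : R[i]) (x : V) :
  rnorm (a *: x) = rnorm (a : R[i]^o) * rnorm x.
Proof.
apply: complexI; rewrite rmorphM/= !rnormE.
by rewrite normrZ.
Qed.

Lemma rnormM (a b : R[i]^o) : rnorm (a * b : R[i]^o) = rnorm a * rnorm b.
Proof. exact: (rnormZ (V := R[i]^o)). Qed.

Lemma rnormX (a : R[i]^o) n : rnorm (a ^+ n : R[i]^o) = rnorm a ^+ n.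
Proof.
elim: n => [|n IHn]; last by rewrite !exprS rnormM IHn.
by rewrite !expr0 /rnorm normr1.
Qed.

Lemma rnormC (r : R) : 0 <= r -> rnorm (r%:C : R[i]^o) = r.
Proof.
by move=> r0; rewrite /rnorm ger0_norm// (_ : 0 = 0%:C)// lecR.
Qed.

Lemma gtc0_Re (e : R[i]) : 0 < e -> 0 < complex.Re e /\ e = (complex.Re e)%:C.
Proof.
by case: e => a b; rewrite ltcE/= => /andP[/eqP -> a0].
Qed.

Lemma gtc0 (e : R) : 0 < e -> (0 : R[i]) < e%:C.
Proof. by rewrite (_ : 0 = 0%:C)// ltcR. Qed.

Lemma ball_rnormE V (x y : V) (e : R) :
  ball x e%:C y = (rnorm (x - y) < e) :> Prop.
Proof. by rewrite -ball_normE/= -rnormE ltcR. Qed.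

Lemma rnorm_cvgP V (T : Type) (F : set_system T) {FF : Filter F} (f : T -> V)
    (l : V) :
  f @ F --> l <-> forall e : R, 0 < e -> \forall t \near F, rnorm (l - f t) < e.
Proof.
split=> [/cvgrPdist_lt fl e e0|fl].
  have := fl _ (gtc0 e0).
  by apply: filterS => t; rewrite -rnormE ltcR.
apply/cvgrPdist_lt => e /gtc0_Re[e0 ->]; have := fl _ e0.
by apply: filterS => t; rewrite -rnormE ltcR.
Qed.

Lemma rnorm_nbhsP V (x : V) (A : set V) :
  nbhs x A <-> exists2 r : R, 0 < r & forall y, rnorm (x - y) < r -> A y.
Proof.
split=> [/nbhs_ballP[e /= /gtc0_Re[e0 eE] eA]|[r r0 rA]].
  exists (complex.Re e) => // y xy; apply: eA.
  by rewrite eE ball_rnormE.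
apply/nbhs_ballP; exists r%:C => /=; first exact: gtc0.
by move=> y; rewrite ball_rnormE; exact: rA.
Qed.

Lemma rnorm_seq_cvgP V (s : nat -> V) (l : V) :
  s @ \oo --> l <-> forall e : R, 0 < e ->
    exists N, forall n, (N <= n)%N -> rnorm (l - s n) < e.
Proof.
split=> [/rnorm_cvgP sl e /sl[N _ Ns]|sl]; first by exists N => n; exact: Ns.
by apply/rnorm_cvgP => e /sl[N Ns]; exists N.
Qed.

Lemma rnorm_lim_le V (s : nat -> V) (l x : V) (c : R) :
  s @ \oo --> l -> (exists N, forall n, (N <= n)%N -> rnorm (x - s n) <= c) ->
  rnorm (x - l) <= c.
Proof.
move=> /rnorm_seq_cvgP sl [N Ns]; apply/ler_addgt0Pr => e /sl[N' Ns'].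
rewrite (le_trans (rnorm_le_distD (s (maxn N N')) _ _))// lerD ?Ns ?leq_maxl//.
by rewrite rnormB ltW// Ns' ?leq_maxr.
Qed.

Lemma cvg_unique_norm V (s : nat -> V) (l l' : V) :
  s @ \oo --> l -> s @ \oo --> l' -> l = l'.
Proof. by move=> sl sl'; exact: (cvg_unique _ sl sl'). Qed.

Lemma rnorm_geometric_lt (A q e : R) : 0 <= q < 1 -> 0 < e ->
  exists N, forall n, (N <= n)%N -> A * q ^+ n < e.
Proof.
move=> /andP[q0 q1] e0.
have : A \*: (fun n => q ^+ n) @ \oo --> A *: 0.
  by apply: cvgZr; apply: cvg_expr; rewrite ger0_norm.
rewrite scaler0 => /cvgrPdist_lt/(_ _ e0)[N _ NA]; exists N => n Nn.
have := NA n Nn; rewrite /= sub0r normrN; apply: le_lt_trans; exact: ler_norm.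
Qed.

(** Telescoping over the steps from [n] to [m] and summing the geometric progression. *)
Lemma geometric_dist V (s : nat -> V) (A q : R) : 0 <= q < 1 ->
  (forall n, rnorm (s n.+1 - s n) <= A * q ^+ n) ->
  forall n m, (n <= m)%N -> rnorm (s m - s n) <= A / (1 - q) * q ^+ n.
Proof.
move=> /andP[q0 q1] sA n m nm.
have A0 : 0 <= A.
  by have := sA 0%N; rewrite mulr1; apply: le_trans (rnorm_ge0 _).
(* The exact geometric sum is carried instead of its upper bound, since only the sharper form is
   stable under the induction on [m]. *)
suff : rnorm (s m - s n) <= A / (1 - q) * (q ^+ n - q ^+ m).
  move/le_trans; apply; apply: ler_wpM2l; last by rewrite gerBl exprn_ge0.
  by rewrite divr_ge0// subr_ge0 ltW.
elim: m nm => [|m IHm].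
  by rewrite leqn0 => /eqP ->; rewrite !subrr mulr0 rnorm0.
rewrite leq_eqVlt => /predU1P[->|]; first by rewrite !subrr mulr0 rnorm0.
rewrite ltnS => /IHm nm.
rewrite (le_trans (rnorm_le_distD (s m) _ _))// (le_trans (lerD (sA m) nm))//.
rewrite exprS le_eqVlt; apply/orP; left; apply/eqP.
have : 1 - q != 0 by rewrite gt_eqF// subr_gt0.
by move=> ?; field.
Qed.

(** Completeness enters as the argument [Vc], so that one lemma serves both complete normed spaces
    and the scalars [R[i]^o]. *)
Lemma geometric_cvg V
    (Vc : forall F : set_system V, ProperFilter F -> cauchy F -> cvg F)
    (s : nat -> V) (A q : R) :
  0 <= q < 1 -> (forall n, rnorm (s n.+1 - s n) <= A * q ^+ n) ->
  exists2 l : V, s @ \oo --> l &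
    forall n, rnorm (l - s n) <= A / (1 - q) * q ^+ n.
Proof.
move=> q01 sA; have sd := geometric_dist q01 sA.
suff /cvg_ex[l sl] : cvgn s.
  exists l => // n; rewrite rnormB; apply: rnorm_lim_le sl _.
  by exists n => m nm; rewrite rnormB; exact: sd.
apply: Vc; apply: cauchy_exP => e /gtc0_Re[e0 ->].
have [N NA] := rnorm_geometric_lt (A / (1 - q)) q01 e0.
exists (s N), N => // n /= Nn.
rewrite ball_rnormE rnormB; apply: le_lt_trans (sd _ _ Nn) _.
exact: NA.
Qed.

End RealNorm.

(** * Completeness of the complex scalars *)

Section ScalarComplete.
Context {R : realType}.

Lemma ler_Re_rnorm (z : R[i]^o) : `|complex.Re z| <= rnorm z.
Proof. by rewrite -lecR rnormE; exact: normc_ge_Re. Qed.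

Lemma ler_Im_rnorm (z : R[i]^o) : `|complex.Im z| <= rnorm z.
Proof.
rewrite /rnorm normc_def/= -sqrtr_sqr; apply: ler_wsqrtr.
by rewrite lerDr sqr_ge0.
Qed.

Lemma ler_rnorm_Re_Im (z : R[i]^o) :
  rnorm z <= `|complex.Re z| + `|complex.Im z|.
Proof.
have s0 : 0 <= `|complex.Re z| + `|complex.Im z| by rewrite addr_ge0.
rewrite /rnorm normc_def/= -(ger0_norm s0) -sqrtr_sqr.
apply: ler_wsqrtr.
by rewrite sqrrD !real_normK ?num_real// lerD2r lerDl mulrn_wge0 ?mulr_ge0.
Qed.

(** Real and imaginary parts are 1-Lipschitz, so they send a Cauchy filter to Cauchy filters on [R];
    their limits are the coordinates of the limit. *)
Lemma scalar_cauchy_cvg (F : set_system R[i]^o) :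
  ProperFilter F -> cauchy F -> cvg F.
Proof.
move=> FF /cauchyP Fc.
have Fpart (g : R[i]^o -> R) : (forall x y, `|g x - g y| <= rnorm (x - y)) ->
    exists l : R, g @ F --> l.
  move=> g1; suff /cvg_ex[l gl] : cvg (g @ F) by exists l.
  apply: cauchy_cvg; apply/cauchyP => e e0.
  have [|z Fz] := Fc e%:C; first exact: gtc0.
  exists (g z); suff : \forall t \near F, ball (g z) e (g t) by [].
  apply: filterS Fz => t; rewrite ball_rnormE -ball_normE/=.
  exact: le_lt_trans.
have [|a /cvgrPdist_lt Fa] := Fpart (@complex.Re R).
  by move=> x y; have := ler_Re_rnorm (x - y); case: x y => ? ? [].
have [|b /cvgrPdist_lt Fb] := Fpart (@complex.Im R).
  by move=> x y; have := ler_Im_rnorm (x - y); case: x y => ? ? [].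
apply/cvg_ex; exists (Complex a b).
apply/(@rnorm_cvgP _ R[i]^o _ F _ id) => e e0.
have e2 : 0 < e / 2 by rewrite divr_gt0.
near=> z; apply: le_lt_trans (ler_rnorm_Re_Im _) _.
rewrite (splitr e); apply: ltrD.
  rewrite (_ : complex.Re _ = a - complex.Re z); last by case: (z).
  by near: z; exact: Fa.
rewrite (_ : complex.Im _ = b - complex.Im z); last by case: (z).
by near: z; exact: Fb.
Unshelve. all: by end_near. Qed.

End ScalarComplete.

(** * Completeness of the dual space *)

Section DualComplete.
Context {R : realType}.
Variable X : normedModType R[i].

Lemma rnorm_dual (f : dual X) (x : X) : rnorm (f x) <= rnorm f * rnorm x.
Proof. by rewrite -lecR rmorphM/= !rnormE; exact: ler_dual_norm. Qed.

Lemma rnorm_dual_le (f : dual X) (c : R) : 0 <= c ->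
  (forall x, rnorm (f x) <= c * rnorm x) -> rnorm f <= c.
Proof.
move=> c0 fc; rewrite -lecR rnormE; apply: dual_norm_le => [|x].
  by rewrite (_ : 0 = 0%:C)// lecR.
rewrite -!rnormE (_ : 1 = 1%:C)// !lecR => x1.
by rewrite (le_trans (fc x))// ler_piMr.
Qed.

Lemma bounded_linear_dual (f : X -> R[i]^o) (c : R) : linear f ->
  (forall x, rnorm (f x) <= c * rnorm x) -> exists g : dual X, g =1 f.
Proof.
move=> fl fc; suff fd : f \in @dual_pred R X by exists (Dual fd).
apply/asboolP; split => // x; apply/rnorm_cvgP => e e0.
(* [c] is an arbitrary real, possibly zero or negative; [|c| + 1] can be divided by. *)
have c1 : 0 < `|c| + 1 by rewrite ltr_wpDl.
apply/rnorm_nbhsP; exists (e / (`|c| + 1)); first by rewrite divr_gt0.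
move=> y; rewrite ltr_pdivlMr// mulrC; apply: le_lt_trans.
have -> : f x - f y = f (x - y).
  by rewrite addrC -scaleN1r -fl scaleN1r addrC.
rewrite (le_trans (fc _))// ler_wpM2r ?rnorm_ge0//.
by rewrite (le_trans (ler_norm c))// lerDl.
Qed.

(** Pointwise limits exist because the scalars are complete. The limit is linear, and bounded
    because it stays close to one functional; the Cauchy estimate, uniform in [x], then gives
    convergence in norm. *)
Lemma dual_cauchy_cvg (F : set_system (dual X)) :
  ProperFilter F -> cauchy F -> cvg F.
Proof.
move=> FF /cauchyP Fc.
have Fr (e : R) : 0 < e -> exists f : dual X,
    \forall g \near F, rnorm (f - g) < e.
  move=> e0; have [|f Ff] := Fc e%:C; first exact: gtc0.
  by exists f; apply: filterS Ff => g; rewrite ball_rnormE.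
have /choice[l Fl] : forall x, exists l : R[i]^o,
    (fun f : dual X => f x) @ F --> l.
  move=> x; suff /cvg_ex[l gl] : cvg ((fun f : dual X => f x : R[i]^o) @ F).
    by exists l.
  apply: (@scalar_cauchy_cvg R); apply/cauchyP => e /gtc0_Re[e0 ->].
  have x1 : 0 < rnorm x + 1 by rewrite ltr_wpDl ?rnorm_ge0.
  have [|f Ff] := Fr (complex.Re e / (rnorm x + 1)); first by rewrite divr_gt0.
  exists (f x).
  suff : F [set g : dual X | ball (f x : R[i]^o) (complex.Re e)%:C (g x)] by [].
  apply: filterS Ff => g /=; rewrite ball_rnormE ltr_pdivlMr//; apply: le_lt_trans.
  apply: le_trans (rnorm_dual (f - g) x) _.
  by rewrite ler_wpM2l ?rnorm_ge0// lerDl.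
have lin : linear l.
  move=> a x y; apply/(cvg_unique _ (Fl _)) => //.
  rewrite (_ : (fun f : dual X => _) = fun f : dual X => a *: (f x : R[i]^o) + f y).
    by apply: cvgD; [exact: cvgZr|].
  by apply/funext => f; rewrite linearP.
(* A bound holding along the filter survives, as a weak inequality, in the pointwise limit [l]. *)
have ldist (f : dual X) (e : R) : (\forall g \near F, rnorm (f - g) < e) ->
    forall x, rnorm (f x - l x) <= e * rnorm x.
  move=> Ff x; apply/ler_addgt0Pr => d d0.
  have /rnorm_cvgP/(_ _ d0) := Fl x => Fd.
  have [g [fg gd]] := filter_ex (filterI Ff Fd).
  rewrite (le_trans (rnorm_le_distD (g x) _ _))// lerD//; last first.
    by rewrite rnormB ltW.
  apply: le_trans (rnorm_dual (f - g) x) _.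
  by rewrite ler_wpM2r ?rnorm_ge0// ltW.
have [f Ff] := Fr 1 ltr01.
have [g gl] : exists g : dual X, g =1 l.
  apply: (@bounded_linear_dual l (rnorm f + 1)) => // x.
  have -> : l x = f x - (f x - l x) by rewrite subKr.
  rewrite (le_trans (rnormD _ _))// mulrDl rnormN.
  by apply: lerD; [exact: rnorm_dual|exact: ldist].
apply/cvg_ex; exists g; apply/(@rnorm_cvgP _ (dual X) _ F _ id) => e e0.
have e2 : 0 < e / 2 by rewrite divr_gt0.
have [h Fh] := Fr _ e2.
apply: filterS (Fh) => k hk.
rewrite (splitr e); apply: le_lt_trans (rnorm_le_distD h _ _) _.
apply: ler_ltD => //; apply: rnorm_dual_le => [|x]; first exact: ltW.
rewrite [(g - h) x](_ : _ = g x - h x)// rnormB gl; exact: ldist.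
Qed.

HB.instance Definition _ := Uniform_isComplete.Build (dual X) dual_cauchy_cvg.

End DualComplete.

(** * Open mapping theorem *)

Section OpenMapping.
Context {R : realType}.

Lemma rnormZr (V : normedModType R[i]) (r : R) (x : V) : 0 <= r ->
  rnorm (r%:C *: x) = r * rnorm x.
Proof. by move=> r0; rewrite rnormZ rnormC. Qed.

Lemma rnorm_closureP (V : normedModType R[i]) (A : set V) (x : V) :
  closure A x <-> forall e : R, 0 < e -> exists2 a, A a & rnorm (x - a) < e.
Proof.
split=> [Ax e e0|Ax U /rnorm_nbhsP[r r0 rU]].
  have [a [Aa xa]] : A `&` [set a | rnorm (x - a) < e] !=set0.
    by apply: Ax; apply/rnorm_nbhsP; exists e.
  by exists a.
by have [a Aa xa] := Ax _ r0; exists a; split => //; exact: rU.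
Qed.

Variable X : completeNormedModType R[i].
Implicit Types (x y : X) (B : set X).

(** Otherwise there are nested balls with halving radii, the one of index [n.+1] missing [C n];
    their centres converge to a point that lies in no [C n]. *)
Lemma baire_cover (C : nat -> set X) : (forall n, closed (C n)) ->
  (forall x, exists n, C n x) ->
  exists n x (r : R), 0 < r /\ forall y, rnorm (x - y) < r -> C n y.
Proof.
move=> Cc CX; apply: contrapT => noball.
(* [p] is an index with a ball (centre, radius). The guard on the radius makes the statement total,
   as needed for the choice function. *)
have step (p : nat * (X * R)) : exists q : X * R, 0 < p.2.2 ->
    [/\ 0 < q.2, q.2 <= p.2.2 / 2, rnorm (p.2.1 - q.1) <= p.2.2 / 2 &
        forall z, rnorm (q.1 - z) <= q.2 -> ~ C p.1 z].
  case: p => n [x r] /=; have [r0|r0] := ltP 0 r; last by exists (x, r).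
  have [y xy Cy] : exists2 y, rnorm (x - y) < r / 2 & ~ C n y.
    apply: contrapT => nC; apply: noball; exists n, x, (r / 2).
    split=> [|y xy]; first by rewrite divr_gt0.
    by apply: contrapT => Cy; apply: nC; exists y.
  have /rnorm_nbhsP[s s0 sC] : nbhs y (~` C n).
    by apply: open_nbhs_nbhs; split => //; apply: closed_openC.
  have t0 : 0 < Num.min (s / 2) (r / 2) by rewrite lt_min !divr_gt0.
  exists (y, Num.min (s / 2) (r / 2)) => _; split=> //=.
  - by rewrite ge_min lexx orbT.
  - exact: ltW.
  - move=> z yz; apply: sC; apply: le_lt_trans yz _.
    by rewrite gt_min ltr_pdivrMr// ltr_pMr// ltr1n.
have [f fP] := choice step.
pose fix p n := if n is m.+1 then f (m, p m) else (0, 1).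
have p0 n : 0 < (p n).2.
  by elim: n => [|n IHn] /=; [exact: ltr01|have [] := fP (n, p n) IHn].
have pS n := fP (n, p n) (p0 n).
have pr n : (p n).2 <= 2^-1 ^+ n.
  elim: n => [|n IHn]; first by rewrite expr0.
  have [_ + _ _] := pS n; move/le_trans; apply => /=.
  by rewrite exprSr ler_wpM2r.
(* This expresses nestedness: the centre moves by at most half the radius, and the radius drops by
   at least half. *)
have nest n m : (n <= m)%N -> rnorm ((p n).1 - (p m).1) <= (p n).2 - (p m).2.
  elim: m => [|m IHm].
    by rewrite leqn0 => /eqP ->; rewrite !subrr rnorm0.
  rewrite leq_eqVlt => /predU1P[->|]; first by rewrite !subrr rnorm0.
  rewrite ltnS => /IHm nm; rewrite (le_trans (rnorm_le_distD (p m).1 _ _))//.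
  have [_ s2 d2 _] := pS m; move: nm s2 d2 => /= nm s2 d2; lra.
have [| |l pl _] := @geometric_cvg R X (@cauchy_cvg X) (fun n => (p n).1) 1 2^-1.
- by apply/andP; split => //; rewrite invf_lt1// ltr1n.
- move=> n; rewrite mul1r rnormB (le_trans (nest n n.+1 _))//.
  by rewrite (le_trans _ (pr n))// lerBlDr lerDl ltW.
have [n Cl] := CX l; have [_ _ _ /(_ l)] := pS n; apply => //.
apply: rnorm_lim_le pl _; exists n.+1 => m nm.
by rewrite (le_trans (nest _ _ nm))// lerBlDr lerDl ltW.
Qed.

(* Zabreiko's form of the open mapping theorem: the proof uses [B] only
   through its closure under midpoints and under absolutely convergent
   convex combinations. *)
Lemma sigma_convex_absorbing B :
  (forall x, exists n : nat, exists2 b, B b & x = (n.+1%:R : R)%:C *: b) ->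
  (forall b c, B b -> B c -> B ((2^-1 : R)%:C *: (b - c))) ->
  (forall (b : nat -> X) y, (forall k, B (b k)) ->
     series (fun k => (2^-1 ^+ k : R)%:C *: b k) @ \oo --> y ->
     B ((2^-1 : R)%:C *: y)) ->
  exists2 c : R, 0 < c &
    forall x, exists2 b, B b & x = (c * rnorm x)%:C *: b.
Proof.
move=> Babs Bmid Bsum.
pose C (n : nat) := [set x | closure B ((n.+1%:R^-1 : R)%:C *: x)].
have [||n [x0 [r [r0 rC]]]] := @baire_cover C.
- move=> n; apply: (@closed_comp _ _ (fun x : X => (n.+1%:R^-1 : R)%:C *: x)).
    by move=> x _; apply: cvgZr; exact: cvg_id.
  exact: closed_closure.
- move=> x; have [n [b Bb ->]] := Babs x; exists n.
  rewrite /C/= scalerA -rmorphM mulVf ?pnatr_eq0//= scale1r.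
  exact: subset_closure.
(* Scaling the ball given by Baire by [t] yields a ball, of centre [x1] and radius [r1], inside the
   closure of [B]. *)
pose t : R := n.+1%:R^-1; have t0 : 0 < t by rewrite invr_gt0.
pose r1 := t * r; have r10 : 0 < r1 by rewrite mulr_gt0.
pose x1 := t%:C *: x0.
have x1B y : rnorm (x1 - y) < r1 -> closure B y.
  move=> xy; have := rC (t^-1%:C *: y).
  rewrite /C/= scalerA -rmorphM divff ?gt_eqF//= scale1r; apply.
  have -> : x0 - t^-1%:C *: y = t^-1%:C *: (x1 - y).
    by rewrite scalerBr scalerA -rmorphM mulVf ?gt_eqF//= scale1r.
  by rewrite rnormZr ?invr_ge0 ?(ltW t0)// mulrC ltr_pdivrMr// mulrC.
(* Both [x1 + y] and [x1 - y] are approximated in [B]; half the difference of the approximants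
   cancels the centre [x1]. *)
have step y : exists b, rnorm y < r1 -> B b /\ rnorm (y - b) < r1 / 2.
  have [yr|yr] := ltP (rnorm y) r1; last by exists 0.
  have r12 : 0 < r1 / 2 by rewrite divr_gt0.
  have [|b Bb bx] := (rnorm_closureP B (x1 + y)).1 _ _ r12.
    by apply: x1B; rewrite opprD addNKr rnormN.
  have [|c Bc cx] := (rnorm_closureP B (x1 - y)).1 _ _ r12.
    by apply: x1B; rewrite opprB addrC subrK.
  exists ((2^-1 : R)%:C *: (b - c)) => _; split; first exact: Bmid.
  have -> : y - (2^-1 : R)%:C *: (b - c) =
      (2^-1 : R)%:C *: ((x1 + y - b) - (x1 - y - c)).
    have {1}-> : y = (2^-1 : R)%:C *: (y + y).
      rewrite scalerDr -scalerDl -rmorphD/= (_ : _ + _ = 1) ?scale1r//.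
      by lra.
    rewrite -scalerBr; congr (_ *: _).
    rewrite -[x1 + y - b]addrA -[x1 - y - c]addrA [- (x1 + _)]opprD.
    by rewrite addrACA subrr add0r !opprD !opprK addrACA.
  rewrite rnormZr ?invr_ge0//; apply: le_lt_trans (_ : _ <= 2^-1 *
      (rnorm (x1 + y - b) + rnorm (x1 - y - c))) _.
    by rewrite ler_pM2l ?invr_gt0// -[rnorm (_ - c)]rnormN rnormD.
  lra.
have [f fP] := choice step.
have half y : rnorm y < r1 -> B ((2^-1 : R)%:C *: y).
  (* The error is doubled and approximated again: after [k] terms of the dyadic series the remainder
     is [2 ^ -k] times [s k]. *)
  move=> yr; pose fix s n :=
    if n is m.+1 then (2 : R)%:C *: (s m - f (s m)) else y.
  have sr k : rnorm (s k) < r1.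
    elim: k => [//|k /fP[_ kr]] /=; rewrite rnormZr//; lra.
  apply: (Bsum (f \o s)) => [k|]; first by have [] := fP _ (sr k).
  have partial k : y - series (fun k => (2^-1 ^+ k : R)%:C *: (f \o s) k) k =
      (2^-1 ^+ k : R)%:C *: s k.
    elim: k => [|k IHk]; first by rewrite /series/= big_geq// subr0 expr0 scale1r.
    rewrite seriesSr opprD addrA IHk /= -scalerBr scalerA -rmorphM/=.
    by rewrite exprSr mulfVK ?pnatr_eq0.
  apply/rnorm_seq_cvgP => e e0.
  have [|N NP] := @rnorm_geometric_lt R r1 2^-1 e _ e0.
    by apply/andP; split => //; rewrite invf_lt1// ltr1n.
  exists N => k /NP; apply: le_lt_trans; rewrite partial rnormZr ?exprn_ge0//.
  by rewrite mulrC ler_pM2r ?exprn_gt0// ltW.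
(* One factor 2 comes from rescaling [x] to norm [r1 / 2], strictly inside the ball, the other from
   the halving in [half]. *)
exists (4 / r1) => [|x]; first by rewrite divr_gt0.
have [->|x_neq0] := eqVneq x 0.
  have [_ [b Bb _]] := Babs 0; exists b => //.
  by rewrite rnorm0 mulr0 scale0r.
have x_gt0 := rnorm_gt0 x_neq0.
exists ((2^-1 : R)%:C *: ((r1 / (2 * rnorm x))%:C *: x)).
  apply: half; rewrite rnormZr ?divr_ge0 ?mulr_ge0 ?ltW//.
  by rewrite invfM mulrA mulfVK ?gt_eqF// ltr_pdivrMr// ltr_pMr// ltr1n.
rewrite !scalerA -!rmorphM/= (_ : _ * _ = 1) ?scale1r//.
by field; rewrite !gt_eqF.
Qed.

End OpenMapping.

(** * Decompositions with norm control *)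

Section Decomposition.
Context {R : realType}.

Lemma cvg_rnormZl (V : normedModType R[i]) (s : nat -> R[i]^o) (l : R[i]^o)
    (x : V) :
  s @ \oo --> l -> (fun n => (s n : R[i]) *: x) @ \oo --> (l : R[i]) *: x.
Proof.
move=> /rnorm_seq_cvgP sl; apply/rnorm_seq_cvgP => e e0.
have x1 : 0 < rnorm x + 1 by rewrite ltr_wpDl ?rnorm_ge0.
have [|N sN] := sl (e / (rnorm x + 1)); first by rewrite divr_gt0.
exists N => n /sN; rewrite ltr_pdivlMr//; apply: le_lt_trans.
by rewrite -scalerBl rnormZ ler_wpM2l ?rnorm_ge0// lerDl.
Qed.

Lemma dyadic_series_cvg (V : normedModType R[i])
    (Vc : forall F : set_system V, ProperFilter F -> cauchy F -> cvg F)
    (b : nat -> V) : (forall k, rnorm (b k) <= 1) ->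
  exists2 l, series (fun k => (2^-1 ^+ k : R)%:C *: b k) @ \oo --> l &
    rnorm l <= 2.
Proof.
move=> b1.
have [||l bl l2] := @geometric_cvg R V Vc
    (series (fun k => (2^-1 ^+ k : R)%:C *: b k)) 1 2^-1.
- by apply/andP; split => //; rewrite invf_lt1// ltr1n.
- move=> n; rewrite seriesSB rnormZr ?exprn_ge0// mulrC ler_wpM2r// exprn_ge0.
exists l => //; have := l2 0%N; rewrite /series/= big_geq// subr0.
by rewrite expr0 mulr1 div1r (_ : (1 - 2^-1)^-1 = 2)//; field.
Qed.

Variables (X : completeNormedModType R[i]) (A : {linear X -> X}).
Variables (L1 L2 L3 : closed_subspace X) (w : nat) (e : 'I_w -> X).
Hypothesis cA : continuous A.

(** A relation rather than an operator on a product space: the open mapping argument uses only that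
    it is linear and closed. *)
Definition decomp (y x u v : X) (c : 'I_w -> R[i]) :=
  [/\ L1 x, L2 u, L3 v & y = A x + u + v + \sum_(i < w) c i *: e i].

Lemma decomp_lin a y x u v c y' x' u' v' c' :
  decomp y x u v c -> decomp y' x' u' v' c' ->
  decomp (a *: y + y') (a *: x + x') (a *: u + u') (a *: v + v')
    (fun i => a * c i + c' i).
Proof.
move=> [? ? ? ->] [? ? ? ->]; split; try exact: csub_lin.
have -> : \sum_(i < w) (a * c i + c' i) *: e i =
    a *: (\sum_(i < w) c i *: e i) + \sum_(i < w) c' i *: e i.
  rewrite scaler_sumr -big_split/=; apply: eq_bigr => i _.
  by rewrite scalerDl scalerA.
rewrite linearP !scalerDr.
by rewrite addrACA [X in X + _]addrACA [X in X + _ + _]addrACA.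
Qed.

Lemma decomp0 : decomp 0 0 0 0 (fun=> 0).
Proof.
split; try exact: csub0.
by rewrite linear0 !addr0 add0r big1// => i _; rewrite scale0r.
Qed.

Lemma eq_decomp y x u v c c' : c =1 c' -> decomp y x u v c -> decomp y x u v c'.
Proof. by move=> /funext ->. Qed.

Lemma decompZ a y x u v c : decomp y x u v c ->
  decomp (a *: y) (a *: x) (a *: u) (a *: v) (fun i => a * c i).
Proof.
move=> yd; have := decomp_lin a yd decomp0; rewrite !addr0.
by under [fun i => _ + _]funext do rewrite addr0.
Qed.

Lemma decompB y x u v c y' x' u' v' c' :
  decomp y x u v c -> decomp y' x' u' v' c' ->
  decomp (y - y') (x - x') (u - u') (v - v') (fun i => c i - c' i).
Proof.
move=> yd yd'; have := decomp_lin (-1) yd' yd; rewrite !scaleN1r !(addrC (- _)).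
by under [fun i => _ + _]funext do rewrite mulN1r addrC.
Qed.

Lemma decomp_cvg (sy sx su sv : nat -> X) (sc : nat -> 'I_w -> R[i]) y x u v c :
  sy @ \oo --> y -> sx @ \oo --> x -> su @ \oo --> u -> sv @ \oo --> v ->
  (forall i, (fun n => sc n i : R[i]^o) @ \oo --> (c i : R[i]^o)) ->
  (forall n, decomp (sy n) (sx n) (su n) (sv n) (sc n)) ->
  decomp y x u v c.
Proof.
move=> syl sxl sul svl scl sd; split.
- by apply: closed_cvg (@csub_closed _ _ L1) _ _ sxl; near=> n; case: (sd n).
- by apply: closed_cvg (@csub_closed _ _ L2) _ _ sul; near=> n; case: (sd n).
- by apply: closed_cvg (@csub_closed _ _ L3) _ _ svl; near=> n; case: (sd n).
- apply: cvg_unique_norm syl _.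
  rewrite (_ : sy = fun n => A (sx n) + su n + sv n + \sum_(i < w) sc n i *: e i).
    apply: cvgD; first (apply: cvgD => //; apply: cvgD => //).
      by apply: continuous_cvg; [exact: cA|].
    elim: (index_enum _) => [|i r IHr].
      by rewrite big_nil; under eq_fun do rewrite big_nil; exact: cvg_cst.
    rewrite big_cons; under eq_fun do rewrite big_cons.
    by apply: cvgD IHr; exact: cvg_rnormZl (scl i).
  by apply/funext => n; case: (sd n).
Unshelve. all: by end_near. Qed.

(** The image of the unit ball of the product of [L1], [L2], [L3] and the coefficient space. *)
Definition unit_decomp : set X := [set y | exists x u v c,
  [/\ decomp y x u v c, rnorm x <= 1, rnorm u <= 1, rnorm v <= 1 &
      forall i, rnorm (c i : R[i]^o) <= 1]].

(** The open mapping theorem for the map sending [(x, u, v, c)] to the decomposed vector, through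
    [sigma_convex_absorbing] for [unit_decomp]. *)
Lemma bounded_decomp : (forall y, exists x u v c, decomp y x u v c) ->
  exists2 C : R, 0 < C & forall y, exists x u v c,
    [/\ decomp y x u v c, rnorm x <= C * rnorm y, rnorm u <= C * rnorm y,
        rnorm v <= C * rnorm y &
        forall i, rnorm (c i : R[i]^o) <= C * rnorm y].
Proof.
move=> surj.
have [|||C C0 Cabs] := @sigma_convex_absorbing R X unit_decomp.
- move=> y; have [x [u [v [c yd]]]] := surj y.
  (* [N] dominates every component, so dividing by an integer above [N] lands in the unit ball. *)
  pose N := rnorm x + rnorm u + rnorm v + \sum_(i < w) rnorm (c i : R[i]^o).
  exists (Num.truncn N).
  have := truncnS_gt N; set n := (Num.truncn N).+1%:R => Nn.
  have sc0 : 0 <= \sum_(i < w) rnorm (c i : R[i]^o).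
    by apply: sumr_ge0 => i _; exact: rnorm_ge0.
  have [x0 u0 v0] := And3 (rnorm_ge0 x) (rnorm_ge0 u) (rnorm_ge0 v).
  have n0 : 0 < n by rewrite ltr0n.
  have n1 : 0 <= n^-1 by rewrite invr_ge0 ltW.
  have le1 r : r <= N -> n^-1 * r <= 1.
    move=> rN; rewrite mulrC ler_pdivrMr// mul1r.
    by rewrite (le_trans rN)// ltW.
  exists ((n^-1 : R)%:C *: y); last first.
    by rewrite scalerA -rmorphM/= divff ?gt_eqF// scale1r.
  exists ((n^-1)%:C *: x), ((n^-1)%:C *: u), ((n^-1)%:C *: v).
  exists (fun i => (n^-1)%:C * c i); split; first exact: decompZ.
  + rewrite rnormZr// le1// /N; lra.
  + rewrite rnormZr// le1// /N; lra.
  + rewrite rnormZr// le1// /N; lra.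
  + move=> i; rewrite rnormM rnormC// le1//.
    have : rnorm (c i : R[i]^o) <= \sum_(i < w) rnorm (c i : R[i]^o).
      by rewrite (bigD1 i)//= lerDl sumr_ge0// => j _; exact: rnorm_ge0.
    rewrite /N; lra.
- move=> y y' [x [u [v [c [yd x1 u1 v1 c1]]]]].
  move=> [x' [u' [v' [c' [yd' x1' u1' v1' c1']]]]].
  have half1 (V : normedModType R[i]) (p q : V) : rnorm p <= 1 -> rnorm q <= 1 ->
      rnorm ((2^-1 : R)%:C *: (p - q)) <= 1.
    move=> p1 q1; rewrite rnormZr//.
    have := rnormD p (- q); rewrite rnormN; lra.
  do 4 eexists; split; first exact: decompZ (decompB yd yd').
  all: try exact: half1.
  by move=> i; exact: (half1 R[i]^o).
- move=> b y ub bl.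
  (* Each component is summed separately; its dyadic series has norm at most 2, which the factor one
     half brings back to 1. *)
  have /choice[d dP] : forall k, exists d : X * X * X * ('I_w -> R[i]),
      [/\ decomp (b k) d.1.1.1 d.1.1.2 d.1.2 d.2, rnorm d.1.1.1 <= 1,
          rnorm d.1.1.2 <= 1, rnorm d.1.2 <= 1 &
          forall i, rnorm (d.2 i : R[i]^o) <= 1].
    by move=> k; have [x [u [v [c ?]]]] := ub k; exists (x, u, v, c).
  have Xc := @cauchy_cvg X.
  have [|x xl x2] := @dyadic_series_cvg X Xc (fun k => (d k).1.1.1).
    by move=> k; case: (dP k).
  have [|u ul u2] := @dyadic_series_cvg X Xc (fun k => (d k).1.1.2).
    by move=> k; case: (dP k).
  have [|v vl v2] := @dyadic_series_cvg X Xc (fun k => (d k).1.2).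
    by move=> k; case: (dP k).
  have /choice[c cl] : forall i, exists c : R[i]^o,
      series (fun k => (2^-1 ^+ k : R)%:C *: ((d k).2 i : R[i]^o)) @ \oo --> c /\
      rnorm c <= 2.
    move=> i.
    have [|c ? ?] := @dyadic_series_cvg R[i]^o (@scalar_cauchy_cvg R)
      (fun k => (d k).2 i); last by exists c.
    by move=> k; case: (dP k).
  have half2 (V : normedModType R[i]) (p : V) : rnorm p <= 2 ->
      rnorm ((2^-1 : R)%:C *: p) <= 1 by move=> p2; rewrite rnormZr//; lra.
  exists ((2^-1 : R)%:C *: x), ((2^-1 : R)%:C *: u), ((2^-1 : R)%:C *: v).
  exists (fun i => (2^-1 : R)%:C * c i); split; try exact: half2.
    apply: decompZ; apply: (decomp_cvg bl xl ul vl (fun i => (cl i).1)).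
    elim=> [|n IHn].
      rewrite /series/= !big_geq//; apply: eq_decomp decomp0 => i.
      by rewrite big_geq.
    have [dn _ _ _ _] := dP n.
    rewrite !seriesSr ![series _ n + _]addrC.
    apply: eq_decomp (decomp_lin (2^-1 ^+ n : R)%:C dn IHn) => i.
    by rewrite big_nat_recr//= addrC.
  by move=> i; apply: (half2 R[i]^o); case: (cl i).
- exists C => // y; have [b [x [u [v [c [bd x1 u1 v1 c1]]]]] {1}->] := Cabs y.
  have Cy : 0 <= C * rnorm y by rewrite mulr_ge0 ?rnorm_ge0// ltW.
  do 4 eexists; split; first exact: decompZ bd.
  1-3: by rewrite rnormZr// ler_piMr.
  by move=> i; rewrite rnormM rnormC// ler_piMr.
Qed.

End Decomposition.

(** * Vector-valued analytic functions *)

Section PowerSeries.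
Context {R : realType}.
Variable Y : completeNormedModType R[i].
Implicit Types (a : nat -> Y) (t : R[i]^o) (A C : R).

Definition psum a t : Y := lim (series (fun k => (t : R[i]) ^+ k *: a k) @ \oo).

(** Explicit constants replace a radius of convergence: the series converges where
    [C * rnorm t < 1], and shifts keep the same [C]. *)
Definition geo_bounded A C a := forall k, rnorm (a k) <= A * C ^+ k.

Lemma geo_bounded_ge0 A C a : geo_bounded A C a -> 0 <= A.
Proof.
by move=> /(_ 0%N); rewrite expr0 mulr1; apply: le_trans; exact: rnorm_ge0.
Qed.

Lemma geo_boundedS A C a n : geo_bounded A C a ->
  geo_bounded (A * C ^+ n) C (fun k => a (n + k)%N).
Proof. by move=> aA k; rewrite -mulrA -exprD. Qed.

Lemma psum_lim a t l :
  series (fun k => (t : R[i]) ^+ k *: a k) @ \oo --> l -> psum a t = l.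
Proof. by move=> sl; apply: cvg_lim sl; exact: norm_hausdorff. Qed.

Lemma psum_cvg_bound A C a t : geo_bounded A C a -> 0 <= C -> C * rnorm t < 1 ->
  series (fun k => (t : R[i]) ^+ k *: a k) @ \oo --> psum a t /\
  rnorm (psum a t) <= A / (1 - C * rnorm t).
Proof.
move=> aA C0 Ct.
have Ct01 : 0 <= C * rnorm t < 1 by rewrite mulr_ge0 ?rnorm_ge0.
have [|l sl lA] := @geometric_cvg R Y (@cauchy_cvg Y)
    (series (fun k => (t : R[i]) ^+ k *: a k)) A _ Ct01.
  move=> n; rewrite seriesSB rnormZ (rnormX t) exprMn mulrA mulrC.
  by rewrite ler_wpM2r// exprn_ge0// rnorm_ge0.
rewrite (psum_lim sl); split => //.
by have := lA 0%N; rewrite /series/= big_geq// subr0 expr0 mulr1.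
Qed.

Lemma psumS A C a t : geo_bounded A C a -> 0 <= C -> C * rnorm t < 1 ->
  psum a t = a 0%N + (t : R[i]) *: psum (fun k => a k.+1) t.
Proof.
move=> aA C0 Ct; apply: psum_lim.
have [sl _] := psum_cvg_bound (geo_boundedS 1 aA) C0 Ct.
rewrite -cvg_shiftS/=.
rewrite (_ : (fun n => _) = fun n => a 0%N +
    (t : R[i]) *: series (fun k => (t : R[i]) ^+ k *: a k.+1) n).
  by apply: cvgD; [exact: cvg_cst|exact: cvgZr].
apply/funext => n; rewrite /series/= big_nat_recl// expr0 scale1r; congr (_ + _).
by rewrite scaler_sumr; apply: eq_bigr => k _; rewrite scalerA exprS.
Qed.

Lemma psum_lin A C A' a b s t : geo_bounded A C a -> geo_bounded A' C b ->
  0 <= C -> C * rnorm t < 1 ->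
  psum (fun k => a k + s *: b k) t = psum a t + s *: psum b t.
Proof.
move=> aA bA C0 Ct; apply: psum_lim.
have [sa _] := psum_cvg_bound aA C0 Ct; have [sb _] := psum_cvg_bound bA C0 Ct.
rewrite (_ : series _ = fun n => series (fun k => (t : R[i]) ^+ k *: a k) n +
    s *: series (fun k => (t : R[i]) ^+ k *: b k) n).
  by apply: cvgD sa _; exact: cvgZr.
apply/funext => n; rewrite /series/= scaler_sumr -big_split/=.
by apply: eq_bigr => k _; rewrite scalerDr !scalerA [s * _]mulrC.
Qed.

(* The coefficients of the divided difference
   [(psum a t - psum a t0) / (t - t0)], as a power series in [t]. *)
Definition divdiff a t0 (k : nat) : Y := psum (fun j => a (k.+1 + j)%N) t0.

Lemma divdiff_bound A C a t0 : geo_bounded A C a -> 0 <= C -> C * rnorm t0 < 1 ->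
  geo_bounded (A * (C / (1 - C * rnorm t0))) C (divdiff a t0).
Proof.
move=> aA C0 Ct k; have [_] := psum_cvg_bound (geo_boundedS k.+1 aA) C0 Ct.
move/le_trans; apply; rewrite exprS le_eqVlt; apply/orP; left.
by apply/eqP; ring.
Qed.

Lemma divdiffE A C a t0 k : geo_bounded A C a -> 0 <= C -> C * rnorm t0 < 1 ->
  divdiff a t0 k = a k.+1 + (t0 : R[i]) *: divdiff a t0 k.+1.
Proof.
move=> aA C0 Ct; rewrite /divdiff (psumS (geo_boundedS k.+1 aA) C0 Ct) addn0.
by congr (_ + _ *: psum _ _); apply/funext => j; rewrite addnS addSn.
Qed.

Lemma psum_divdiff A C a t0 t : geo_bounded A C a -> 0 <= C ->
  C * rnorm t0 < 1 -> C * rnorm t < 1 ->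
  psum a t = psum a t0 + (t - t0 : R[i]) *: psum (divdiff a t0) t.
Proof.
move=> aA C0 Ct0 Ct.
have dA := divdiff_bound aA C0 Ct0.
have E1 := psumS aA C0 Ct; have E2 := psumS aA C0 Ct0.
have E3 := psumS dA C0 Ct.
have E4 : psum (divdiff a t0) t = psum (fun k => a k.+1) t +
    (t0 : R[i]) *: psum (fun k => divdiff a t0 k.+1) t.
  rewrite -(psum_lin _ (geo_boundedS 1 aA) (geo_boundedS 1 dA) C0 Ct).
  by congr psum; apply/funext => k; rewrite (divdiffE _ aA C0 Ct0).
rewrite scalerBl {1}E4 {}E3 E1 E2 -/(divdiff a t0 0).
rewrite !scalerDr !scalerA [t0 * t]mulrC -!addrA; congr (_ + _).
by rewrite opprD [- _ - _]addrC addNKr addrC subrK.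
Qed.

(* The [n]-th Taylor coefficient at [t0] is the value at [t0] of the [n]-fold
   divided difference, and the remainder is [(t - t0) ^ n] times that divided
   difference at [t]; this avoids rearranging a double series. *)
Fixpoint taylor a t0 n : nat -> Y :=
  if n is m.+1 then divdiff (taylor a t0 m) t0 else a.

Lemma taylor_bound A C a t0 n : geo_bounded A C a -> 0 <= C ->
  C * rnorm t0 < 1 ->
  geo_bounded (A * (C / (1 - C * rnorm t0)) ^+ n) C (taylor a t0 n).
Proof.
move=> aA C0 Ct; elim: n => [|n IHn]; first by rewrite expr0 mulr1.
by rewrite exprSr mulrA; exact: divdiff_bound.
Qed.

Lemma taylor_remainder A C a t0 t n : geo_bounded A C a -> 0 <= C ->
  C * rnorm t0 < 1 -> C * rnorm t < 1 ->
  psum a t = series (fun k => (t - t0 : R[i]) ^+ k *: psum (taylor a t0 k) t0) n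
    + (t - t0 : R[i]) ^+ n *: psum (taylor a t0 n) t.
Proof.
move=> aA C0 Ct0 Ct; elim: n => [|n IHn].
  by rewrite /series/= big_geq// add0r expr0 scale1r.
rewrite seriesSr -addrA {}IHn; congr (_ + _).
rewrite (psum_divdiff (taylor_bound n aA C0 Ct0) C0 Ct0 Ct).
by rewrite scalerDr scalerA exprSr.
Qed.

(** By [taylor_remainder] and [taylor_bound], the error after [n] terms at [z1] is at most a
    constant times [(q * rnorm (z - z1)) ^ n]. *)
Lemma psum_analytic A C a z0 : geo_bounded A C a -> 0 <= C ->
  analytic_on [set z | C * rnorm (z - z0) < 1] (fun z => psum a (z - z0)).
Proof.
move=> aA C0 z1 /= Cz1; exists (fun k => psum (taylor a (z1 - z0) k) (z1 - z0)).
set q := C / (1 - C * rnorm (z1 - z0)).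
have d0 : 0 < 1 - C * rnorm (z1 - z0) by rewrite subr_gt0.
have q0 : 0 <= q by rewrite divr_ge0// ltW.
(* The first bound keeps [z] in the original disc, the second makes [q * rnorm (z - z1) < 1]; adding
   1 avoids dividing by zero. *)
pose r := Num.min ((1 - C * rnorm (z1 - z0)) / (C + 1)) (q + 1)^-1.
have C1 : 0 < C + 1 by rewrite ltr_wpDl.
have q1 : 0 < q + 1 by rewrite ltr_wpDl.
apply/rnorm_nbhsP; exists r; first by rewrite lt_min divr_gt0// invr_gt0.
move=> z; rewrite lt_min ltr_pdivlMr// => /andP[zC zq].
have nz := rnorm_ge0 (z1 - z).
have Cz : C * rnorm (z - z0) < 1.
  have := rnorm_le_distD z1 z z0; rewrite [rnorm (z - z1)]rnormB => zz.
  have : C * rnorm (z - z0) <= C * (rnorm (z1 - z) + rnorm (z1 - z0)).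
    by rewrite ler_wpM2l.
  rewrite mulrDr; nra.
have qz : 0 <= q * rnorm (z - z1) < 1.
  rewrite mulr_ge0 ?rnorm_ge0//= rnormB.
  have : rnorm (z1 - z) * (q + 1) < 1.
    by rewrite -ltr_pdivlMr// div1r.
  nra.
have [_ zA] := psum_cvg_bound aA C0 Cz.
apply/rnorm_seq_cvgP => e e0.
have [N NP] := rnorm_geometric_lt (A / (1 - C * rnorm (z - z0))) qz e0.
exists N => n /NP; apply: le_lt_trans.
have zz1 : z - z1 = (z - z0) - (z1 - z0) by rewrite opprB addrA subrK.
rewrite {1}(taylor_remainder n aA C0 Cz1 Cz) -zz1 addrC addKr.
rewrite rnormZ (rnormX (z - z1)).
have [_] := psum_cvg_bound (taylor_bound n aA C0 Cz1) C0 Cz.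
rewrite exprMn => /(ler_wpM2l (exprn_ge0 n (rnorm_ge0 (z - z1)))).
move/le_trans; apply; rewrite le_eqVlt; apply/orP; left; apply/eqP.
by rewrite /q !exprMn; ring.
Qed.

(** The terms of a convergent series are bounded: from [N] on they are differences of partial sums
    within 1 of [l], hence at most 2, and their sum covers the first [N]. *)
Lemma geo_bounded_of_cvg a t (l : Y) : t != 0 ->
  series (fun k => (t : R[i]) ^+ k *: a k) @ \oo --> l ->
  exists A, geo_bounded A (rnorm t)^-1 a.
Proof.
move=> t_neq0 /rnorm_seq_cvgP sl; have t0 := rnorm_gt0 t_neq0.
have [N sN] := sl 1 ltr01.
pose b k := rnorm ((t : R[i]) ^+ k *: a k).
have b0 k : 0 <= b k by exact: rnorm_ge0.
exists (2 + \sum_(k < N) b k) => k.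
have tk : 0 < rnorm t ^+ k by rewrite exprn_gt0.
suff : b k <= 2 + \sum_(k < N) b k.
  by rewrite /b rnormZ (rnormX t) exprVn ler_pdivlMr// mulrC.
have [Nk|kN] := leqP N k; last first.
  rewrite (bigD1 (Ordinal kN))//= addrCA lerDl addr_ge0//.
  by apply: sumr_ge0 => i _; exact: b0.
have S0 : 0 <= \sum_(k < N) b k by apply: sumr_ge0 => i _; exact: b0.
have := sN _ Nk; have := sN _ (leqW Nk).
have -> : b k = rnorm (series (fun k => (t : R[i]) ^+ k *: a k) k.+1 -
    series (fun k => (t : R[i]) ^+ k *: a k) k) by rewrite seriesSB.
move=> s1 s2; apply: le_trans (rnorm_le_distD l _ _) _.
rewrite [X in X + _]rnormB; lra.
Qed.

Lemma psum_drop A C a t n : geo_bounded A C a -> 0 <= C -> C * rnorm t < 1 ->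
  (forall k, (k < n)%N -> a k = 0) ->
  psum a t = (t : R[i]) ^+ n *: psum (fun k => a (n + k)%N) t.
Proof.
move=> aA C0 Ct; elim: n => [_|n IHn a0]; first by rewrite expr0 scale1r.
rewrite IHn => [|k /ltnW]; last exact: a0.
rewrite (psumS (geo_boundedS n aA) C0 Ct) addn0 a0// add0r scalerA -exprSr.
by congr (_ *: psum _ _); apply/funext => k; rewrite addnS addSn.
Qed.

(** Once the coefficients below [n] vanish, dividing by [t ^ n] at a zero [t] gives
    [a n = - t * tail], with a tail bounded near 0. *)
Lemma psum_zeros A C a : geo_bounded A C a -> 0 <= C ->
  (forall e : R, 0 < e -> exists t, [/\ t != 0, rnorm t < e & psum a t = 0]) ->
  forall n, a n = 0.
Proof.
move=> aA C0 az n; elim/ltn_ind: n => n IHn; apply: rnorm_eq0; apply: le_anti.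
rewrite rnorm_ge0 andbT; apply/ler_addgt0Pl => e e0; rewrite addr0.
have C1 : 0 < 2 * (C + 1) by rewrite mulr_gt0// ltr_wpDl.
have A0 := geo_bounded_ge0 aA.
pose K := A * C ^+ n.+1 * 2.
have K0 : 0 <= K by rewrite !mulr_ge0// exprn_ge0.
have K1 : 0 < K + 1 by rewrite ltr_wpDl.
(* The first bound gives [C * rnorm t < 1 / 2], so the tail is at most [K]; the second makes
   [rnorm t * K] smaller than [e]. *)
have [|t [t_neq0 + at0]] := az (Num.min (2 * (C + 1))^-1 (e / (K + 1))).
  by rewrite lt_min invr_gt0 C1 divr_gt0.
rewrite lt_min -[_^-1]div1r !ltr_pdivlMr// => /andP[tC tK].
have t0 := rnorm_ge0 t.
have Ct : C * rnorm t < 2^-1 by nra.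
have Ct1 : C * rnorm t < 1 by lra.
have := psum_drop aA C0 Ct1 IHn; rewrite at0 => /esym/eqP.
rewrite scaler_eq0 expf_eq0 (negbTE t_neq0) andbF/=.
rewrite (psumS (geo_boundedS n aA) C0 Ct1) addn0 addr_eq0 => /eqP ->.
rewrite rnormN rnormZ.
have [_ SK] := psum_cvg_bound (geo_boundedS 1 (geo_boundedS n aA)) C0 Ct1.
have {SK} : rnorm (psum (fun k => a (n + (1 + k))%N) t) <= K.
  apply: le_trans SK _; rewrite /K [C ^+ n.+1]exprSr expr1 !mulrA ler_wpM2l//.
    by rewrite !mulr_ge0// exprn_ge0.
  rewrite invf_ple ?posrE ?subr_gt0//; lra.
rewrite (_ : (fun k => a (n + (1 + k))%N) = (fun k => a (n + k.+1)%N))//.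
nra.
Qed.

End PowerSeries.

(** * Identity theorem on connected open sets *)

Section IdentityTheorem.
Context {R : realType}.
Variables (Y : completeNormedModType R[i]) (U : set R[i]^o) (f : R[i]^o -> Y).
Hypotheses (oU : open U) (fU : analytic_on U f).

Definition zeros_cluster (z : R[i]^o) := forall e : R, 0 < e ->
  exists y : R[i]^o, [/\ y != z, rnorm (y - z) < e & f y = 0].

Lemma analytic_locally_eq0 z : U z -> zeros_cluster z ->
  nbhs z [set y | f y = 0].
Proof.
move=> Uz zacc; have [a /rnorm_nbhsP[d d0 da]] := fU Uz.
(* Convergence at this single nonzero point already bounds the coefficients geometrically. *)
pose t : R[i]^o := (d / 2)%:C.
have d2 : 0 < d / 2 by rewrite divr_gt0.
have tE : rnorm t = d / 2 by rewrite rnormC// ltW.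
have t_neq0 : t != 0 by apply/eqP => t0; move: tE; rewrite t0 rnorm0; lra.
have [|A aA] := @geo_bounded_of_cvg R Y a t (f (z + t)) t_neq0.
  have := da (z + t); rewrite opprD addNKr rnormN tE -addrA [t - z]addrC addNKr.
  by apply; lra.
have a0 : forall n, a n = 0.
  apply: (psum_zeros aA); first by rewrite invr_ge0 rnorm_ge0.
  move=> e e0; have [|y [yz yd fy]] := zacc (Num.min e d).
    by rewrite lt_min e0.
  move: yd; rewrite lt_min => /andP[ye yd].
  exists (y - z); split => //; first by rewrite subr_eq0.
  by rewrite -fy; apply: psum_lim; apply: da; rewrite rnormB.
apply/rnorm_nbhsP; exists d => // y /da sy; apply: cvg_unique_norm sy _.
rewrite (_ : series _ = fun=> 0); first exact: cvg_cst.
by apply/funext => n; rewrite /series/= big1// => k _; rewrite a0 scaler0.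
Qed.

(** The interior [Z] of the zero set is closed relative to [U], because every point of its closure
    is a cluster point of zeros. *)
Lemma analytic_eq0 (z0 : R[i]^o) : connected U -> U z0 -> zeros_cluster z0 ->
  forall z, U z -> f z = 0.
Proof.
move=> cU Uz0 z0acc; pose Z := [set y | f y = 0]°.
have Zacc z e : closure Z z -> 0 < e ->
    exists y : R[i]^o, [/\ y != z, rnorm (y - z) < e & f y = 0].
  move=> /rnorm_closureP Zz e0; have e2 : 0 < e / 2 by rewrite divr_gt0.
  have [y /rnorm_nbhsP[r r0 rf] zy] := Zz _ e2.
  (* If the approximating point is [z] itself, then [z] is interior to the zero set and a small
     shift gives a different zero. *)
  have [yz|yz] := eqVneq y z; last first.
    exists y; split => //; first by rewrite rnormB; lra.
    by apply: rf; rewrite subrr rnorm0.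
  pose d := Num.min (r / 2) (e / 2).
  have d0 : 0 < d by rewrite lt_min !divr_gt0.
  have dr : d <= r / 2 by rewrite ge_min lexx.
  have de : d <= e / 2 by rewrite ge_min lexx orbT.
  exists (y + (d%:C : R[i]^o)); rewrite -yz; split.
  - rewrite -subr_eq0 [y + _]addrC addrK; apply/eqP => dE.
    have := rnormC (ltW d0); rewrite dE rnorm0 => d00.
    by move: d0; rewrite -d00 ltxx.
  - rewrite [y + _]addrC addrK rnormC ?(ltW d0)//; lra.
  - apply: rf; rewrite opprD addNKr rnormN rnormC ?(ltW d0)//; lra.
suff UE : U `&` Z = U.
  by move=> z; rewrite -UE => -[_ Zz]; exact: (interior_subset Zz).
apply: cU.
- by exists z0; split => //; exact: analytic_locally_eq0.
- by exists Z => //; exact: open_interior.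
- exists (closure Z); first exact: closed_closure.
  apply/seteqP; split => z [Uz Zz]; split => //; first exact: subset_closure.
  by apply: analytic_locally_eq0 => // e e0; exact: Zacc.
Qed.

End IdentityTheorem.

(** * Discs and isolated points in the plane *)

Section Plane.
Context {R : realType}.

Lemma disc_open (l : R[i]^o) (C r : R) : 0 < C ->
  open [set z : R[i]^o | C * rnorm (z - l) < r].
Proof.
move=> C0; rewrite openE => z /= zr; apply/rnorm_nbhsP.
exists ((r - C * rnorm (z - l)) / C); first by rewrite divr_gt0// subr_gt0.
move=> y; rewrite ltr_pdivlMr// => zy /=.
have := rnorm_le_distD z y l; rewrite [rnorm (y - z)]rnormB; nra.
Qed.

Lemma disc_connected (l : R[i]^o) (C r : R) : 0 < C -> 0 < r ->
  connected [set z : R[i]^o | C * rnorm (z - l) < r].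
Proof.
move=> C0 r0; set D := (X in connected X).
pose seg (z : R[i]^o) (t : R) : R[i]^o := l + (t%:C : R[i]) *: (z - l).
(* A disc is a union of segments, all through its centre. *)
have -> : D = \bigcup_(z in D) (seg z @` `[0, 1]).
  apply/seteqP; split => [z Dz|y [z Dz [t + <-]]].
    exists z => //; exists 1; first by rewrite /= in_itv/= ler01 lexx.
    by rewrite /seg scale1r addrC subrK.
  rewrite /= in_itv/= => /andP[t0 t1]; rewrite /D/= /seg addrC addKr rnormZr//.
  by apply: le_lt_trans Dz; rewrite ler_pM2l// ler_piMl// rnorm_ge0.
apply: bigcup_connected.
  exists l => z Dz; exists 0; first by rewrite /= in_itv/= ler01 lexx.
  by rewrite /seg scale0r addr0.
move=> z Dz; apply: connected_continuous_connected; first exact: segment_connected.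
apply: continuous_subspaceT => t; apply/rnorm_cvgP => e e0.
have z1 : 0 < rnorm (z - l) + 1 by rewrite ltr_wpDl ?rnorm_ge0.
near=> s; rewrite /seg opprD addrACA subrr add0r -scalerBl -rmorphB rnormZ.
have : rnorm ((t - s)%:C : R[i]^o) = `|t - s|.
  have [ts|ts] := leP 0 (t - s); first by rewrite rnormC ?ger0_norm.
  rewrite -[LHS]rnormN -rmorphN/= rnormC ?oppr_ge0 ?ltW//.
  by rewrite ltr0_norm.
move=> /= ->; apply: (@le_lt_trans _ _ (`|t - s| * (rnorm (z - l) + 1))).
  by rewrite ler_wpM2l// lerDl.
rewrite -ltr_pdivlMr//; near: s; apply/nbhs_ballP.
by exists (e / (rnorm (z - l) + 1)) => //=; rewrite divr_gt0.
Unshelve. all: by end_near. Qed.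

(** Each point is coded by its isolation scale and its cell in the square grid of mesh [1 / n.+1].
    Two points of [E] with the same code are closer than [2 / n.+1], hence equal. *)
Lemma countable_isolated_plane (E : set R[i]^o) : E `<=` isolated E ->
  countable E.
Proof.
move=> Eiso.
have sep z : exists n : nat, E z ->
    forall y, E y -> rnorm (z - y) < 2 / n.+1%:R -> y = z.
  have [Ez|] := pselect (E z); last by exists 0%N.
  have [_ [V /rnorm_nbhsP[r r0 rV] VE]] := Eiso z Ez.
  exists (Num.truncn (2 / r)) => _ y Ey zy.
  have : (V `&` E) y.
    split => //; apply: rV; apply: lt_le_trans zy _.
    by rewrite ler_pdivrMr ?ltr0n// -ler_pdivrMl// mulrC ltW// truncnS_gt.
  by rewrite VE.
have [n nP] := choice sep.
pose code (z : R[i]^o) := (n z, Num.floor (complex.Re z * (n z).+1%:R),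
  Num.floor (complex.Im z * (n z).+1%:R)).
apply/countable_injP; exists (choice.pickle \o code) => z y.
rewrite !inE => Ez Ey /(pcan_inj choice.pickleK) [nE].
rewrite -nE => reE imE; apply/esym/(nP z Ez) => //.
have N0 : 0 < (n z).+1%:R :> R by rewrite ltr0n.
have floor_close (p q : R) : Num.floor p = Num.floor q -> `|p - q| < 1.
  move=> pq; have := floor_itv p; have := floor_itv q; rewrite pq intrD1.
  move=> /andP[q1 q2] /andP[p1 p2]; rewrite ltr_norml; lra.
apply: le_lt_trans (ler_rnorm_Re_Im _) _.
have {reE} := floor_close _ _ reE; have {imE} := floor_close _ _ imE.
rewrite -!mulrBl !normrM !(gtr0_norm N0) -!ltr_pdivlMr// => imE reE.
have -> : complex.Re (z - y) = complex.Re z - complex.Re y.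
  by case: (z) (y) => ? ? [].
have -> : complex.Im (z - y) = complex.Im z - complex.Im y.
  by case: (z) (y) => ? ? [].
by rewrite [ltRHS]mulrDl; exact: ltrD.
Qed.

End Plane.

(** * Local structure at a pseudo B-Fredholm point *)

Section MinimalDecomposition.
Context {R : realType}.
Variables (X : completeNormedModType R[i]) (A : {linear X -> X}).
Variables (M N : closed_subspace X).
Hypotheses (cA : continuous A) (AM : invariant_subspace M A)
  (MN : direct_sum M N).

Lemma csubD (L : closed_subspace X) x y : L x -> L y -> L (x + y).
Proof. by move=> Lx Ly; rewrite -[x]scale1r; exact: csub_lin. Qed.

Lemma csubZ (L : closed_subspace X) (a : R[i]) x : L x -> L (a *: x).
Proof.
by move=> Lx; rewrite -[_ *: _]addr0; apply: csub_lin Lx _; exact: csub0.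
Qed.

Lemma csubN (L : closed_subspace X) x : L x -> L (- x).
Proof. by rewrite -scaleN1r; exact: csubZ. Qed.

Lemma csub_sum (L : closed_subspace X) n (F : 'I_n -> X) :
  (forall i, L (F i)) -> L (\sum_(i < n) F i).
Proof.
by move=> LF; elim/big_ind: _ => //; [exact: csub0|exact: csubD].
Qed.

Lemma iter_linear n : linear (iter n A).
Proof.
by elim: n => [//|n IHn] a x y; rewrite !iterS IHn linearP.
Qed.

Lemma iter_continuous n : continuous (iter n A).
Proof.
elim: n => [|n IHn] x; first exact: cvg_id.
by apply: (@continuous_comp _ _ _ (iter n A) A); [exact: IHn|exact: cA].
Qed.

Lemma iter_lin0 n : iter n A 0 = 0.
Proof. by elim: n => [//|n IHn]; rewrite iterS IHn linear0. Qed.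

Definition kerpow_set n : X -> Prop := fun x => M x /\ iter n A x = 0.

Lemma kerpow0 n : kerpow_set n 0.
Proof. by split; [exact: csub0|exact: iter_lin0]. Qed.

Lemma kerpow_lin n (a : R[i]) x y :
  kerpow_set n x -> kerpow_set n y -> kerpow_set n (a *: x + y).
Proof.
move=> [Mx x0] [My y0]; split; first exact: csub_lin.
by rewrite iter_linear x0 y0 scaler0 addr0.
Qed.

Lemma kerpow_closed n : closed (kerpow_set n : set X).
Proof.
rewrite (_ : (kerpow_set n : set X) = M `&` iter n A @^-1` [set 0]).
  apply: closedI; first exact: csub_closed.
  apply: closed_comp; first by move=> x _; exact: iter_continuous.
  exact/accessible_closed_set1/hausdorff_accessible/norm_hausdorff.
by apply/seteqP; split.
Qed.

Definition kerpow n :=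
  ClosedSubspace (kerpow0 n) (@kerpow_lin n) (@kerpow_closed n).

Lemma kerpowW n m x : (n <= m)%N -> kerpow n x -> kerpow m x.
Proof.
move=> nm [Mx x0]; split=> //.
by rewrite -(subnK nm) iterD x0 iter_lin0.
Qed.

Lemma decompW w (e : 'I_w -> X) n m y x u v c : (n <= m)%N ->
  decomp A M (kerpow n) N e y x u v c -> decomp A M (kerpow m) N e y x u v c.
Proof. by move=> nm [? Ku ? ?]; split => //; exact: kerpowW Ku. Qed.

(** [w] is minimised jointly over exponents and vectors, so that relations are excluded for every
    exponent [m], not only for [n]. *)
Lemma minimal_decomp : finite_codim (range (restrict_op AM)) ->
  exists w n (e : 'I_w -> X),
  (forall y, exists x u v c, decomp A M (kerpow n) N e y x u v c) /\
  (forall m x u v c, decomp A M (kerpow m) N e 0 x u v c -> forall i, c i = 0).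
Proof.
move=> [w0 [e0 we0]].
pose P w := exists n (e : 'I_w -> X), forall y,
  exists x u v c, decomp A M (kerpow n) N e y x u v c.
have exP : exists w, `[< P w >].
  (* With exponent 0 the kernel part is zero, and the finite codimension in [M] suffices. *)
  exists w0; apply/asboolP; exists 0%N, (fun i => csub_val (e0 i)).
  move=> y.
  have [_ /seteqP[_ /(_ y Logic.I)[p Mp [q Nq <-]]]] := MN.
  have /asboolP Mp' := Mp.
  have /seteqP[_ /(_ (Csub Mp') Logic.I)[_ [x _ <-] [_ [c _ <-] pE]]] := we0.
  exists (csub_val x), 0, q, c; split => //; try exact: csub0; first exact: csubP.
  have <- : A (csub_val x) + \sum_(i < w0) c i *: csub_val (e0 i) = p.
    rewrite -[p]/(csub_val (Csub Mp')) -pE.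
    have valD : {morph @csub_val R X M : a b / a + b} by [].
    have val0 : csub_val (0 : csub M) = 0 by [].
    by rewrite valD (big_morph _ valD val0).
  by rewrite addr0 addrAC.
have [w /asboolP[n [e ey]] wmin] := ex_minnP exP.
exists w, n, e; split => // m x u v c cd i; apply: contrapT => /eqP ci.
case: w => [|w] in e ey wmin c cd i ci *; first by case: i ci.
(* The relation expresses [e i] through the other [e j], against minimality. *)
suff /asboolP/wmin : P w by rewrite ltnn.
exists (maxn n m), (e \o lift i) => y.
have [x' [u' [v' [c' yd]]]] := ey y.
have yd' := decompW (leq_maxl n m) yd.
have := decomp_lin (- (c' i / c i)) (decompW (leq_maxr n m) cd) yd'.
rewrite scaler0 add0r => -[Mx Ku Nv yE].
do 4 eexists; split; [exact: Mx|exact: Ku|exact: Nv|].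
rewrite {1}yE; congr (_ + _); rewrite (bigD1_ord i)//= mulNr divfK// addNr scale0r.
by rewrite add0r.
Qed.

End MinimalDecomposition.

(** * No complementing vector: surjectivity nearby *)

Section Surjective.
Context {R : realType}.
Variables (X : completeNormedModType R[i]) (A : {linear X -> X}).
Variables (M N : closed_subspace X).
Hypotheses (cA : continuous A) (AN : invariant_subspace N A)
  (qN : quasi_nilpotent (restrict_op AN)).

Lemma csub_geometric (L : closed_subspace X) (b : nat -> X) (B q : R) :
  0 <= q < 1 -> (forall k, L (b k)) -> (forall k, rnorm (b k) <= B * q ^+ k) ->
  exists2 l, series b @ \oo --> l & L l.
Proof.
move=> q01 Lb bB.
have [|l bl _] := @geometric_cvg R X (@cauchy_cvg X) (series b) B q q01.
  by move=> n; rewrite seriesSB.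
exists l => //; apply: closed_cvg (@csub_closed _ _ L) _ _ bl.
near=> n; rewrite /series/= big_mkord; exact: csub_sum.
Unshelve. all: by end_near. Qed.

Lemma shift_op_linear (m : R[i]) : linear (shift_op A m).
Proof.
move=> a x y; rewrite /shift_op linearP scalerDr opprD addrACA scalerBr.
by rewrite !scalerA mulrC.
Qed.

HB.instance Definition _ (m : R[i]) :=
  GRing.isLinear.Build R[i] X X _ (shift_op A m) (shift_op_linear m).

(** If [A u = (A - m) x], then [(A - m) (x - u) = m u]; induction on the nilpotency exponent. *)
Lemma kerpow_range (m : R[i]) n u : m != 0 -> kerpow M cA n u ->
  range (shift_op A m) u.
Proof.
move=> m0 [_]; elim: n u => [|n IHn] u.
  by move=> /= ->; exists 0; rewrite ?linear0.
rewrite iterSr => /IHn[x _ xE]; exists (m^-1 *: (x - u)) => //.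
rewrite linearZ linearB/= xE /shift_op subKr scalerA mulVf ?scale1r//.
Qed.

Lemma quasi_nilpotent_range (m : R[i]) v : m != 0 -> N v ->
  range (shift_op A m) v.
Proof.
move=> m0 Nv; have : resolvent_set (restrict_op AN) m.
  by apply: contrapT => /qN /= /eqP; rewrite (negbTE m0).
move=> [Q [_ _ QK]]; have /asboolP Nv' := Nv.
exists (csub_val (Q (Csub Nv'))) => //.
exact: (congr1 (@csub_val R X N) (QK (Csub Nv'))).
Qed.

Lemma shift_surjective n (e : 'I_0 -> X) (C : R) : 0 < C ->
  (forall y, exists x u v c,
    [/\ decomp A M (kerpow M cA n) N e y x u v c, rnorm x <= C * rnorm y,
        rnorm u <= C * rnorm y, rnorm v <= C * rnorm y &
        forall i, rnorm (c i : R[i]^o) <= C * rnorm y]) ->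
  forall m : R[i]^o, m != 0 -> C * rnorm m < 1 ->
  forall y, exists x, shift_op A m x = y.
Proof.
move=> C0 dC m m0 mC y0.
have /choice[d dP] : forall y, exists d : X * X * X,
    [/\ M d.1.1, kerpow M cA n d.1.2, N d.2, y = A d.1.1 + d.1.2 + d.2 &
    [/\ rnorm d.1.1 <= C * rnorm y, rnorm d.1.2 <= C * rnorm y &
        rnorm d.2 <= C * rnorm y]].
  move=> y; have [x [u [v [c [[Mx Ku Nv yE] xC uC vC _]]]]] := dC y.
  by exists (x, u, v); rewrite big_ord0 addr0 in yE; split.
(* Replacing [A] by [A - m] in the decomposition of [y k] leaves the error [m x], which is the next
   [y]; it contracts by [C * rnorm m]. *)
pose fix y n := if n is k.+1 then (m : R[i]) *: (d (y k)).1.1 else y0.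
have q01 : 0 <= C * rnorm m < 1 by rewrite mulr_ge0 ?rnorm_ge0// ltW.
have yq k : rnorm (y k) <= rnorm y0 * (C * rnorm m) ^+ k.
  elim: k => [|k IHk]; first by rewrite expr0 mulr1.
  have [_ _ _ _ [xk _ _]] := dP (y k).
  rewrite /= rnormZ (le_trans (ler_wpM2l (rnorm_ge0 m) xk))//.
  by rewrite mulrA [_ * C]mulrC exprS mulrCA ler_wpM2l// mulr_ge0 ?rnorm_ge0// ltW.
have bq (b : nat -> X) : (forall k, rnorm (b k) <= C * rnorm (y k)) ->
    forall k, rnorm (b k) <= C * rnorm y0 * (C * rnorm m) ^+ k.
  by move=> bC k; rewrite (le_trans (bC k))// -mulrA ler_pM2l.
have [x xl Mx] := csub_geometric (L := M) (b := fun k => (d (y k)).1.1) q01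
  (fun k => let: And5 h _ _ _ _ := dP (y k) in h)
  (bq _ (fun k => let: And5 _ _ _ _ (And3 h _ _) := dP (y k) in h)).
have [u ul Ku] := csub_geometric (L := kerpow M cA n)
  (b := fun k => (d (y k)).1.2) q01
  (fun k => let: And5 _ h _ _ _ := dP (y k) in h)
  (bq _ (fun k => let: And5 _ _ _ _ (And3 _ h _) := dP (y k) in h)).
have [v vl Nv] := csub_geometric (L := N) (b := fun k => (d (y k)).2) q01
  (fun k => let: And5 _ _ h _ _ := dP (y k) in h)
  (bq _ (fun k => let: And5 _ _ _ _ (And3 _ _ h) := dP (y k) in h)).
have y0E : y0 = shift_op A m x + u + v.
  have partial k : y0 = shift_op A m (series (fun k => (d (y k)).1.1) k) +
      series (fun k => (d (y k)).1.2) k + series (fun k => (d (y k)).2) k + y k.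
    elim: k => [|k IHk]; first by rewrite /series/= !big_geq// linear0 !addr0 add0r.
    rewrite !seriesSr {1}IHk; have [_ _ _ yE _] := dP (y k).
    rewrite linearD [X in _ = X + _ + _]addrACA [X in _ = X + _]addrACA -[RHS]addrA.
    congr (_ + _); rewrite {1}yE /= [RHS]addrAC [X in _ = X + _]addrAC /shift_op.
    by rewrite subrK.
  apply: (@cvg_unique_norm _ _ (fun=> y0)); first exact: cvg_cst.
  rewrite -[_ + v]addr0 (funext partial); apply: cvgD; first apply: cvgD vl.
    apply: cvgD ul; apply: (continuous_cvg _ _ xl).
    by apply: cvgB; [exact: cA|apply: cvgZr; exact: cvg_id].
  apply/rnorm_seq_cvgP => r r0.
  have [K KP] := rnorm_geometric_lt (rnorm y0) q01 r0.
  by exists K => k /KP; apply: le_lt_trans; rewrite sub0r rnormN.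
have [x1 _ uE] := kerpow_range m0 Ku.
have [x2 _ vE] := quasi_nilpotent_range m0 Nv.
by exists (x + x1 + x2); rewrite !linearD/= uE vE.
Qed.

End Surjective.

(** * Some complementing vector: a chain of functionals *)

Section AnnihilatingFunctionals.
Context {R : realType}.
Variables (X : completeNormedModType R[i]) (A : {linear X -> X}).
Variables (M N : closed_subspace X).
Hypotheses (cA : continuous A) (AM : invariant_subspace M A)
  (AN : invariant_subspace N A) (MN : direct_sum M N).
Variables (w n : nat) (e : 'I_w.+1 -> X) (C : R).
Hypothesis C0 : 0 < C.
Hypothesis dC : forall y, exists x u v c,
  [/\ decomp A M (kerpow M cA n) N e y x u v c, rnorm x <= C * rnorm y,
      rnorm u <= C * rnorm y, rnorm v <= C * rnorm y &
      forall i, rnorm (c i : R[i]^o) <= C * rnorm y].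
Hypothesis ind : forall m x u v c,
  decomp A M (kerpow M cA m) N e 0 x u v c -> forall i, c i = 0.

Let K m := kerpow M cA m.

(** With zero coefficients, [A x + u] is in [M] and equals [- v] in [N], so both vanish and
    [A x = - u] is killed by the [m]-th power. *)
Lemma decomp_ker m x u v c : decomp A M (K m) N e 0 x u v c ->
  K m.+1 x /\ forall i, c i = 0.
Proof.
move=> cd; have c0 := ind cd; split => //.
have [Mx [Mu Ku] Nv /esym] := cd.
rewrite big1 => [|i _]; last by rewrite c0 scale0r.
rewrite addr0 => /eqP; rewrite addr_eq0 => /eqP vE.
have v0 : v = 0.
  have /seteqP[/(_ v) + _] := MN.1; apply; split => //.
  by rewrite -[v]opprK -vE; apply: csubN; apply: csubD => //; exact: AM.
move/eqP: vE; rewrite v0 oppr0 addr_eq0 => /eqP vE.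
split => //; rewrite iterSr vE -[- u]scaleN1r -[_ *: u]addr0.
by rewrite iter_linear Ku scaler0 add0r iter_lin0.
Qed.

(* A linear form in the data of a decomposition that vanishes on the kernels
   of the powers of [A] does not depend on the decomposition chosen. *)
Lemma decomp_functional (phi : X -> ('I_w.+1 -> R[i]) -> R[i]^o) (B : R) :
  (forall a x c x' c', phi (a *: x + x') (fun i => a * c i + c' i) =
     a * phi x c + phi x' c') ->
  (forall m x, K m x -> phi x (fun=> 0) = 0) ->
  (forall x c r, rnorm x <= r -> (forall i, rnorm (c i : R[i]^o) <= r) ->
     rnorm (phi x c) <= B * r) ->
  exists2 g : dual X, rnorm g <= B * C &
    forall m y x u v c, decomp A M (K m) N e y x u v c -> g y = phi x c.
Proof.
move=> phil phiK phiB.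
have /choice[d dP] : forall y, exists d : X * ('I_w.+1 -> R[i]),
    (exists u v, decomp A M (K n) N e y d.1 u v d.2) /\
    rnorm (phi d.1 d.2) <= B * C * rnorm y.
  move=> y; have [x [u [v [c [yd xC _ _ cC]]]]] := dC y.
  by exists (x, c); split; [exists u, v|rewrite -mulrA; exact: phiB].
have phi_unique m y x u v c : decomp A M (K m) N e y x u v c ->
    phi (d y).1 (d y).2 = phi x c.
  move=> yd; have [[u' [v' yd']] _] := dP y.
  (* At a common exponent, two decompositions of [y] differ by a decomposition of 0. *)
  have := decomp_lin (-1) (decompW (leq_maxl m n) yd) (decompW (leq_maxr m n) yd').
  rewrite scaleN1r addNr => /decomp_ker[Kx c0].
  have := phil (-1) x c (d y).1 (d y).2.
  rewrite (funext c0) (phiK _ _ Kx) mulN1r addrC => /esym/eqP.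
  by rewrite subr_eq0 => /eqP.
have gl : linear (fun y => phi (d y).1 (d y).2).
  move=> a y y'; have [[u [v yd]] _] := dP y; have [[u' [v' yd']] _] := dP y'.
  by rewrite (phi_unique _ _ _ _ _ _ (decomp_lin a yd yd')) phil.
have [g gE] := bounded_linear_dual gl (fun y => (dP y).2).
have BC0 : 0 <= B * C.
  rewrite mulr_ge0 ?(ltW C0)//; have := phiB 0 (fun=> 0) 1.
  rewrite rnorm0 mulr1 => /(_ ler01 (fun=> _)) B0.
  apply: le_trans (rnorm_ge0 _) (B0 _); rewrite rnorm0; exact: ler01.
exists g => [|m y x u v c yd]; last by rewrite gE; exact: phi_unique yd.
by apply: rnorm_dual_le => // y; rewrite gE; case: (dP y).
Qed.

Lemma decomp_kerpow m u : K m u -> decomp A M (K m) N e u 0 u 0 (fun=> 0).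
Proof.
move=> Ku; split => //; try exact: csub0.
by rewrite linear0 add0r addr0 big1 ?addr0// => i _; rewrite scale0r.
Qed.

Lemma decomp_compl v : N v -> decomp A M (K 0) N e v 0 0 v (fun=> 0).
Proof.
move=> Nv; split => //; try exact: csub0.
by rewrite linear0 !add0r big1 ?addr0// => i _; rewrite scale0r.
Qed.

Lemma decomp_range x : M x -> decomp A M (K 0) N e (A x) x 0 0 (fun=> 0).
Proof.
move=> Mx; split => //; try exact: csub0.
by rewrite !addr0 big1 ?addr0// => i _; rewrite scale0r.
Qed.

Lemma decomp_basis j :
  decomp A M (K 0) N e (e j) 0 0 0 (fun i => (i == j)%:R).
Proof.
split; try exact: csub0.
rewrite linear0 !add0r (bigD1 j)//= eqxx scale1r big1 ?addr0// => i /negbTE ->.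
by rewrite scale0r.
Qed.

(** All exponents are required: the ambiguity of [x] in a decomposition with exponent [m] lies in
    the kernel of exponent [m.+1]. *)
Definition kills (g : dual X) :=
  (forall m u, K m u -> g u = 0) /\ (forall v, N v -> g v = 0).

(** The coordinate along [e ord0] is well defined by [ind]. *)
Lemma functional_base : exists g : dual X, [/\ kills g,
  forall x, M x -> g (A x) = 0 & g (e ord0) = 1].
Proof.
have [||x c r _ cr|g _ gE] := @decomp_functional (fun _ c => c ord0) 1.
- by [].
- by [].
- by rewrite mul1r.
exists g; split; [split=> [m u Ku|v Nv]|move=> x Mx|].
- exact: gE (decomp_kerpow Ku).
- exact: gE (decomp_compl Nv).
- exact: gE (decomp_range Mx).
- by rewrite (gE _ _ _ _ _ _ (decomp_basis ord0)).
Qed.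

(** [g'] evaluates [g] at the [M]-component [x] of a decomposition; the constant [C] of [dC]
    controls its norm. *)
Lemma functional_step (g : dual X) : kills g -> exists g' : dual X,
  [/\ kills g', rnorm g' <= rnorm g * C, forall x, M x -> g' (A x) = g x &
      g' (e ord0) = 0].
Proof.
move=> [gK gN].
have [|m x Kx|x c r xr _|g' g'C gE] :=
    @decomp_functional (fun x _ => g x) (rnorm g).
- by move=> a x c x' c'; rewrite linearP.
- exact: gK Kx.
- by rewrite (le_trans (rnorm_dual g x))// ler_wpM2l ?rnorm_ge0.
have g0 : g 0 = 0 by rewrite linear0.
exists g'; split => //; [split=> [m u Ku|v Nv]|move=> x Mx|].
- by rewrite (gE _ _ _ _ _ _ (decomp_kerpow Ku)).
- by rewrite (gE _ _ _ _ _ _ (decomp_compl Nv)).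
- by rewrite (gE _ _ _ _ _ _ (decomp_range Mx)).
- by rewrite (gE _ _ _ _ _ _ (decomp_basis ord0)).
Qed.

Lemma functional_chain : exists (a : nat -> dual X) (B : R),
  [/\ geo_bounded B C a, forall k v, N v -> a k v = 0,
      forall x, M x -> a 0%N (A x) = 0 /\ forall k, a k.+1 (A x) = a k x &
      a 0%N (e ord0) = 1 /\ forall k, a k.+1 (e ord0) = 0].
Proof.
have [g0 [g0k g0A g0e]] := functional_base.
have step (g : dual X) : exists g' : dual X, kills g -> [/\ kills g',
    rnorm g' <= rnorm g * C, forall x, M x -> g' (A x) = g x & g' (e ord0) = 0].
  have [/functional_step[g' gP]|gk] := pselect (kills g); first by exists g'.
  by exists 0.
have [F FP] := choice step.
have kF k : kills (iter k F g0).
  by elim: k => [//|k /FP[]].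
exists (fun k => iter k F g0), (rnorm g0); split.
- elim=> [|k IHk]; first by rewrite expr0 mulr1.
  have [_ + _ _] := FP _ (kF k); move/le_trans; apply.
  by rewrite exprSr mulrA ler_pM2r.
- by move=> k v Nv; have [_ ->] := kF k.
- move=> x Mx; split=> [|k]; first exact: g0A.
  by have [_ _ ->] := FP _ (kF k).
- by split => // k; have [] := FP _ (kF k).
Qed.

End AnnihilatingFunctionals.

(** * Summing the chain to an analytic family *)

Section AnalyticKernel.
Context {R : realType}.
Variables (X : completeNormedModType R[i]).

Lemma psum_dual_cvg (a : nat -> dual X) (t : R[i]^o) (g : dual X) (x : X) :
  series (fun k => (t : R[i]) ^+ k *: a k) @ \oo --> g ->
  series (fun k => (t : R[i]) ^+ k *: (a k x : R[i]^o)) @ \oo --> (g x : R[i]^o).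
Proof.
move=> /rnorm_seq_cvgP sg; apply/rnorm_seq_cvgP => r r0.
have x1 : 0 < rnorm x + 1 by rewrite ltr_wpDl ?rnorm_ge0.
have [|K KP] := sg (r / (rnorm x + 1)); first by rewrite divr_gt0.
exists K => k /KP; rewrite ltr_pdivlMr//; apply: le_lt_trans.
have -> : series (fun k => (t : R[i]) ^+ k *: (a k x : R[i]^o)) k =
    series (fun k => (t : R[i]) ^+ k *: a k) k x.
  elim: k => [|k IHk]; first by rewrite /series/= !big_geq.
  by rewrite !seriesSr IHk.
apply: le_trans (rnorm_dual (g - series (fun k => (t : R[i]) ^+ k *: a k) k) x) _.
by rewrite ler_wpM2l ?rnorm_ge0// lerDl.
Qed.

(** On [N] every term vanishes. On [M] the chain relations shift the series, so composing the sum
    with [A] multiplies it by [t]. At [e0] only the constant term remains. *)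
Lemma analytic_kernel (A : {linear X -> X}) (M N : closed_subspace X)
    (a : nat -> dual X) (B C : R) (e0 : X) (t : R[i]^o) :
  invariant_subspace N A -> direct_sum M N ->
  0 < C -> geo_bounded B C a -> C * rnorm t < 1 ->
  (forall k v, N v -> a k v = 0) ->
  (forall x, M x -> a 0%N (A x) = 0 /\ forall k, a k.+1 (A x) = a k x) ->
  a 0%N e0 = 1 -> (forall k, a k.+1 e0 = 0) ->
  psum a t e0 = 1 /\ forall x, psum a t (shift_op A t x) = 0.
Proof.
move=> AN MN C0 aB Ct aN aA ae0 aeS.
have [sa _] := psum_cvg_bound aB (ltW C0) Ct.
have [sS _] := psum_cvg_bound (geo_boundedS 1 aB) (ltW C0) Ct.
have pE := psumS aB (ltW C0) Ct.
have eq0 x (b : nat -> dual X) (g : dual X) :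
    series (fun k => (t : R[i]) ^+ k *: b k) @ \oo --> g ->
    (forall k, b k x = 0) -> g x = 0.
  move=> /(@psum_dual_cvg _ _ _ x) sb bx; apply: cvg_unique_norm sb _.
  rewrite (_ : series _ = fun=> 0); first exact: cvg_cst.
  by apply/funext => k; rewrite /series/= big1// => j _; rewrite bx scaler0.
have pN v : N v -> psum a t v = 0 by move=> Nv; apply: eq0 sa _ => k; exact: aN.
split=> [|x].
  rewrite pE [LHS](_ : _ = a 0%N e0 + t * psum (fun k => a k.+1) t e0)//.
  by rewrite (eq0 _ _ _ sS aeS) mulr0 addr0.
have [_ /seteqP[_ /(_ x Logic.I)[p Mp [q Nq <-]]]] := MN.
have [aAp0 aApS] := aA p Mp.
have SE : psum (fun k => a k.+1) t (A p) = psum a t p.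
  have /(@psum_dual_cvg _ _ _ (A p)) := sS.
  rewrite (_ : (fun k => t ^+ k *: _) = (fun k => t ^+ k *: (a k p : R[i]^o))).
    by move/cvg_unique_norm; apply; exact: psum_dual_cvg.
  by apply/funext => k; rewrite add1n aApS.
have pA : psum a t (A p) = t * psum a t p.
  rewrite {1}pE [LHS](_ : _ = a 0%N (A p) + t * psum (fun k => a k.+1) t (A p))//.
  by rewrite aAp0 SE add0r.
rewrite /shift_op linearB linearZ/= !linearD/= pA (pN q Nq) (pN _ (AN _ Nq)).
by rewrite scaler0 subr0 addr0; exact: subrr.
Qed.

End AnalyticKernel.

(** * The local alternative and its consequences *)

Section LocalDichotomy.
Context {R : realType}.
Variables (X : completeNormedModType R[i]) (T : {linear X -> X}).
Hypothesis cT : continuous T.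

Definition surjective_around (l : R[i]^o) := exists2 r : R, 0 < r &
  forall z : R[i]^o, z != l -> rnorm (z - l) < r ->
    forall y, exists x, shift_op T z x = y.

(** The value 1 at a fixed [x0] keeps the family nonzero on the whole disc. *)
Definition analytic_kernel_around (l : R[i]^o) :=
  exists (C : R) (f : R[i]^o -> dual X) (x0 : X), [/\ 0 < C,
    analytic_on [set z | C * rnorm (z - l) < 1] f &
    forall z, C * rnorm (z - l) < 1 ->
      f z x0 = 1 /\ forall x, f z (shift_op T z x) = 0].

Lemma shift_opB (l z : R[i]) x :
  shift_op (shift_op T l) (z - l) x = shift_op T z x.
Proof. by rewrite /shift_op scalerBl opprB addrA subrK. Qed.

Lemma shift_op_continuous (l : R[i]) : continuous (shift_op T l).
Proof.
by move=> x; apply: cvgB; [exact: cT|apply: cvgZr; exact: cvg_id].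
Qed.

Lemma pseudo_B_Fredholm_dichotomy (l : R[i]^o) :
  pseudo_B_Fredholm (shift_op T l) ->
  surjective_around l \/ analytic_kernel_around l.
Proof.
move=> [M [N [AM [AN [MN [_ fc] qN]]]]].
pose A : {linear X -> X} := shift_op T l.
have cA : continuous A := @shift_op_continuous l.
have [w [n [e [surj ind]]]] := @minimal_decomp R X A M N cA AM MN fc.
have [C C0 dC] := bounded_decomp cA surj.
case: w => [|w] in e surj ind dC *; [left|right].
  exists C^-1; first by rewrite invr_gt0.
  move=> z zl zC y.
  have [||x <-] := @shift_surjective R X A M N cA AN qN n e C C0 dC (z - l) _ _ y.
  - by rewrite subr_eq0.
  - by rewrite -ltr_pdivlMl ?mulr1.
  - by exists x; exact/esym/shift_opB.
have [a [B [aB aN aA [ae0 aeS]]]] := functional_chain AM MN C0 dC ind.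
exists C, (fun z => psum a (z - l)), (e ord0); split => //.
  exact: psum_analytic aB (ltW C0).
move=> z zC.
have [fe fA] := analytic_kernel AN MN C0 aB zC aN aA ae0 aeS.
by split => // x; rewrite -(shift_opB l z x); exact: fA.
Qed.

Lemma surjective_around_open : open surjective_around.
Proof.
rewrite openE => l [r r0 lr]; apply/rnorm_nbhsP; exists r => // z zr.
have [->|zl] := eqVneq z l; first by exists r.
have zl0 : 0 < rnorm (z - l) by rewrite rnorm_gt0// subr_eq0.
have rz : 0 < r - rnorm (l - z) by rewrite subr_gt0.
exists (Num.min (rnorm (z - l)) (r - rnorm (l - z))); first by rewrite lt_min zl0.
move=> y yz; rewrite lt_min => /andP[yzl yr]; apply: lr.
  by apply/eqP => yl; move: yzl; rewrite yl rnormB ltxx.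
by have := rnorm_le_distD z y l; rewrite [rnorm (z - l)]rnormB; lra.
Qed.

Lemma adjoint_shift (g : dual X) (z : R[i]) (x : X) :
  shift_op (adjoint cT) z g x = g (shift_op T z x).
Proof. by rewrite /shift_op [RHS]linearB [X in _ = _ - X]linearZ. Qed.

(** A functional killed by the adjoint of [T - z] vanishes on the range of [T - z]. So [f] is zero
    at points of [U] arbitrarily close to [l], and the identity theorem applies. *)
Lemma surjective_around_SVEP (l : R[i]^o) :
  surjective_around l -> SVEP (adjoint cT) l.
Proof.
move=> [r r0 lr] U oU cU Ul f fU fz; apply: (analytic_eq0 fU cU Ul) => e e0.
have /rnorm_nbhsP[d d0 dU] : nbhs l U by exact: open_nbhs_nbhs.
pose s := Num.min r (Num.min d e) / 2.
have m0 : 0 < Num.min r (Num.min d e) by rewrite !lt_min r0 d0.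
have s0 : 0 < s by rewrite divr_gt0.
have : s < Num.min r (Num.min d e) by rewrite /s; lra.
rewrite !lt_min => /and3P[sr sd se].
pose z : R[i]^o := l + (s%:C : R[i]^o).
have zlE : z - l = s%:C by rewrite /z addrC addKr.
have zl : rnorm (z - l) = s by rewrite zlE rnormC// ltW.
have z_neq : z != l.
  by apply/eqP => zE; move: zl; rewrite zE subrr rnorm0; lra.
exists z; split => //; first by rewrite zl.
have Uz : U z by apply: dU; rewrite rnormB zl.
apply: val_inj; apply/funext => y.
have [|x <-] := lr z z_neq _ y; first by rewrite zl.
exact: etrans (esym (adjoint_shift _ _ _)) (congr1 (@^~ x) (congr1 val (fz z Uz))).
Qed.

Lemma analytic_kernel_not_SVEP (l : R[i]^o) :
  analytic_kernel_around l -> ~ SVEP (adjoint cT) l.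
Proof.
move=> [C [f [x0 [C0 fan fk]]]] /(_ [set z | C * rnorm (z - l) < 1]).
have Dl : [set z | C * rnorm (z - l) < 1] l by rewrite /= subrr rnorm0 mulr0.
move=> /(_ (@disc_open R l C 1 C0) (@disc_connected R l C 1 C0 ltr01) Dl f fan).
case: (fk l Dl) => fl1 _ /(_ _ l Dl) f0; move: fl1.
rewrite f0 => [/esym/eqP|z /fk[_ fz]]; first by rewrite oner_eq0.
apply: val_inj; apply/funext => x.
exact: etrans (adjoint_shift _ _ _) (fz x).
Qed.

Lemma analytic_kernel_deficiency (l : R[i]^o) :
  analytic_kernel_around l -> nbhs l (deficiency_value T).
Proof.
move=> [C [f [x0 [C0 _ fk]]]].
have : nbhs l [set z | C * rnorm (z - l) < 1].
  apply: open_nbhs_nbhs; split; first exact: disc_open.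
  by rewrite /= subrr rnorm0 mulr0.
apply: filterS => z /fk[fz1 fz0] /(_ x0 Logic.I)[x _ xE].
by move: fz1; rewrite -xE fz0 => /esym/eqP; rewrite oner_eq0.
Qed.

Lemma surjective_around_deficiency (l z : R[i]^o) (r : R) :
  (forall z : R[i]^o, z != l -> rnorm (z - l) < r ->
    forall y, exists x, shift_op T z x = y) ->
  deficiency_value T z -> rnorm (z - l) < r -> z = l.
Proof.
move=> lr dz zr; apply: contrapT => /eqP zl; apply: dz => y _.
by have [x xE] := lr z zl zr y; exists x.
Qed.

(** This makes the two local alternatives exclusive, by [analytic_kernel_deficiency]. *)
Lemma surjective_around_not_nbhs (l : R[i]^o) :
  surjective_around l -> ~ nbhs l (deficiency_value T).
Proof.
move=> [r r0 lr] /rnorm_nbhsP[d d0 dd].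
pose s := Num.min r d / 2.
have m0 : 0 < Num.min r d by rewrite lt_min r0.
have s0 : 0 < s by rewrite divr_gt0.
have : s < Num.min r d by rewrite /s; lra.
rewrite lt_min => /andP[sr sd].
pose z : R[i]^o := l + (s%:C : R[i]^o).
have zl : rnorm (z - l) = s by rewrite /z addrC addKr rnormC// ltW.
have zE : z = l.
  apply: surjective_around_deficiency lr _ _; last by rewrite zl.
  by apply: dd; rewrite rnormB zl.
by move: zl; rewrite zE subrr rnorm0; lra.
Qed.

End LocalDichotomy.

(** * The alternative on a component *)

Theorem theorem3p2 (R : realType) (X : completeNormedModType R[i])
    (T : {linear X -> X}) (T_continuous : continuous T)
    (Omega : set R[i]^o)
    (Omega_component : exists2 l0 : R[i]^o,
       rho_pBF T l0 & Omega = connected_component (rho_pBF T) l0) :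
  [/\ forall l, Omega l -> SVEP (adjoint T_continuous) l,
      limit_point (surjectivity_spectrum T) `&` Omega = set0
    & exists E : set R[i]^o,
        [/\ E `<=` Omega, countable E, E `<=` isolated E
          & forall l, Omega l -> ~ E l -> ~ deficiency_value T l]]
  \/
  (forall l, Omega l -> ~ SVEP (adjoint T_continuous) l) /\
  (forall l, Omega l -> deficiency_value T l).
Proof.
have [l0 _ OmegaE] := Omega_component.
have cO : connected Omega by rewrite OmegaE; exact: component_connected.
have dich l : Omega l -> surjective_around T l \/ analytic_kernel_around T l.
  rewrite OmegaE => /connected_component_sub.
  exact: pseudo_B_Fredholm_dichotomy.
have [[l1 [Ol1 sl1]]|noP] := pselect (exists l, Omega l /\ surjective_around T l).
  (* On [Omega] the open set [surjective_around T] coincides with the complement of the interior of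
     the deficiency values, so its trace is also relatively closed. *)
  left; have OS : Omega `&` surjective_around T = Omega.
    apply: cO; first by exists l1.
    - by exists (surjective_around T) => //; exact: surjective_around_open.
    - exists (~` (deficiency_value T : set R[i]^o)°).
        by apply: open_closedC; exact: open_interior.
      apply/seteqP; split => l [Ol]; first by move/surjective_around_not_nbhs.
      by case: (dich l Ol) => // /analytic_kernel_deficiency.
  have Os l : Omega l -> surjective_around T l by rewrite -{1}OS => -[].
  split.
  - by move=> l /Os; exact: surjective_around_SVEP.
  - rewrite -subset0 => l [ll /Os[r r0 lr]].
    have [|y [yl dy yr]] := ll [set z | rnorm (l - z) < r].
      by apply/rnorm_nbhsP; exists r.
    move/eqP: yl; apply; apply: surjective_around_deficiency lr dy _.
    by rewrite rnormB.
  (* The exceptional set consists of all deficiency values in [Omega]; a punctured disc without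
     deficiency values isolates each of them. *)
  - pose E := Omega `&` surjectivity_spectrum T.
    have Eiso : E `<=` isolated E.
      move=> l El; split; first exact/mem_set.
      have [r r0 lr] := Os l El.1.
      exists [set z | rnorm (l - z) < r]; first by apply/rnorm_nbhsP; exists r.
      apply/seteqP; split => [z [/= zr [_ dz]]|_ ->].
        by apply: surjective_around_deficiency lr dz _; rewrite rnormB.
      by split => //=; rewrite subrr rnorm0.
    exists E; split => //; first by move=> l [].
      exact: countable_isolated_plane.
    by move=> l Ol nE dl; apply: nE.
right; have Oa l : Omega l -> analytic_kernel_around T l.
  by move=> Ol; have [sl|//] := dich l Ol; case: noP; exists l.
split=> l /Oa; first exact: analytic_kernel_not_SVEP.
by move/analytic_kernel_deficiency/nbhs_singleton.
Qed.
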